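(* (1) The translation cover of the octahedron and the translation cover of the compact quotient of Octa-8 are isometric (with respect to their intrinsic flat metrics). (2) The translation cover of the cube and the translation cover of the compact quotient of Mucube are isometric (with respect to their intrinsic flat metrics).
   Context: All polyhedral faces are regular Euclidean polygons with edge length normalized to a common value for the two surfaces being compared, and all surfaces carry the intrinsic metric induced by their faces: a flat metric with cone singularities at some vertices. ''Octahedron'' and ''cube'' denote the boundary surfaces (topological spheres) of the regular octahedron and the cube. Translation cover. Let $Y$ be a closed oriented surface tiled by regular polygons, $\Sigma$ its set of vertices, such that the rotational holonomy of the flat metric on $Y\setminus\Sigma$ is a cyclic group of rotations of finite order $k$ (so that $Y$ is given by a meromorphic $k$-differential, $k$ minimal). The translation cover (also called spectral curve or unfolding) of $Y$ is the connected $k$-fold cyclic cover of $Y$, branched only over $\Sigma$, obtained by completing the cover of $Y\setminus \Sigma$ corresponding to the kernel of the holonomy homomorphism, with the pulled back flat metric; it is a translation surface. Concretely, take $k$ copies of $Y$ (cut into planar polygons), each rotated by $2\pi/k$ from the previous one, and glue each edge of a copy to the corresponding edge of another copy by translation. (If $k=1$ the translation cover is $Y$ itself.) Octa-8. Let $O\subset\mathbb{R}^3$ be the regular octahedron with vertices $\pm e_1,\pm e_2,\pm e_3$, and let $\Lambda$ be the lattice generated by the vectors $\tfrac43(\pm1,\pm1,\pm1)$. For each of the eight faces $F$ of $O$ let $O_F$ be the reflection of $O$ in the plane of $F$ (a regular octahedron meeting $O$ in the common face $F$, and meeting a translate of $O$ by an element of $\Lambda$ in the opposite face). Octa-8 is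 the triply periodic polyhedral surface $\Pi$ which is the boundary of $\bigcup_{\lambda\in\Lambda}\bigl(\lambda+(O\cup\bigcup_F O_F)\bigr)$; it is tiled by equilateral triangles, twelve at each vertex (type $\{3,12\}$). Its compact quotient is $\Pi/\Lambda$, of genus four with 24 triangles. Mucube. Mucube is the Coxeter--Petrie surface of type $\{4,6\}$, namely the boundary $\Pi$ of $\bigcup_{\lambda\in 2\mathbb{Z}^3}\bigl(\lambda+(C\cup(C+e_1)\cup(C+e_2)\cup(C+e_3))\bigr)$, where $C=[0,1]^3$; it is tiled by unit squares, six at each vertex. Its compact quotient is $\Pi/(2\mathbb{Z}^3)$, of genus three with 12 squares. *)

(* Defs.v *)
From Stdlib Require Export Relation_Operators.
From mathcomp Require Export all_boot all_order all_algebra.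
From mathcomp Require Export all_classical all_reals all_analysis.
From mathcomp Require Export complex.

Set Implicit Arguments.
Unset Strict Implicit.
Unset Printing Implicit Defensive.

Import Order.TTheory GRing.Theory Num.Theory.
Import numFieldNormedType.Exports.

Local Open Scope classical_set_scope.
Local Open Scope ring_scope.

(* The convex hull of the members of s. *)
Definition hull (R : realType) (V : lmodType R) (s : seq V) : set V :=
  [set x | exists w : 'I_(size s) -> R,
     [/\ forall i, 0 <= w i, \sum_i w i = 1 & x = \sum_i w i *: s`_i]].

(* Side i of a polygon given by its cyclic list of vertices. *)
Definition side (V : nmodType) (s : seq V) (i : nat) : V * V :=
  (s`_i, s`_(i.+1 %% size s)%N).

Section TiledSurfaces.
Variable R : realType.
(* The Euclidean plane: complex numbers as a real vector space, with the real
   number `|z| as norm. *)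
Local Notation C := (Rcomplex R).

(* A surface presented as planar polygons glued along sides.  The vertices of
   each polygon are listed counterclockwise, and [glued f i g j] means that side
   i of f is sewn to side j of g, the two sides being traversed in opposite
   directions, so that the result is oriented. *)
Record tiled_surface := TiledSurface {
  tile : Type;
  corners : tile -> seq C;
  glued : tile -> nat -> tile -> nat -> Prop
}.

Section IntrinsicMetric.
Variable Y : tiled_surface.

Definition in_tile (f : tile Y) : set C := hull (corners f).

Definition sewn (x y : tile Y * C) : Prop :=
  exists i j (t : R), [/\ glued x.1 i y.1 j, 0 <= t <= 1,
    x.2 = (1 - t) *: (side (corners x.1) i).1 + t *: (side (corners x.1) i).2 &
    y.2 = (1 - t) *: (side (corners y.1) j).2 + t *: (side (corners y.1) j).1].

Definition same_point : tile Y * C -> tile Y * C -> Prop :=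
  clos_refl_sym_trans _ sewn.

Definition points : set (set (tile Y * C)) :=
  [set A | exists2 x, in_tile x.1 x.2 & A = [set y | same_point x y]].

(* [broken_line x y l]: some path on the surface from x to y is a concatenation
   of straight segments, each inside one tile, of total length l. *)
Inductive broken_line : tile Y * C -> tile Y * C -> R -> Prop :=
| broken_nil x : broken_line x x 0
| broken_seg f z z' y l : in_tile f z -> in_tile f z' ->
    broken_line (f, z') y l ->
    broken_line (f, z) y (`|z' - z| + l)
| broken_jump x x' y l : same_point x x' ->
    broken_line x' y l -> broken_line x y l.

Definition intrinsic_dist (A B : set (tile Y * C)) : \bar R :=
  ereal_inf [set l%:E | l in
    [set l | exists x y, [/\ A x, B y & broken_line x y l]]].

End IntrinsicMetric.

Arguments points : clear implicits.

Definition isometric (Y Z : tiled_surface) : Prop :=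
  exists phi : set (tile Y * C) -> set (tile Z * C),
    set_bij (points Y) (points Z) phi /\
    forall A B, points Y A -> points Y B ->
      intrinsic_dist (phi A) (phi B) = intrinsic_dist A B.

Section TranslationCover.
Variables (Y : tiled_surface) (f0 : tile Y).

Definition direction (f : tile Y) (i : nat) : C :=
  (side (corners f) i).2 - (side (corners f) i).1.

(* If f is drawn in the plane rotated by u and g rotated by v, then side i of f
   and side j of g differ by a translation. *)
Definition translation_match (f : tile Y) (u : C) i (g : tile Y) (v : C) j :=
  u * direction f i = - (v * direction g j).

(* [transport f0 f u]: unfolding the tiles in the plane along some path of tiles
   that starts at f0 and crosses sides (a path avoiding the vertices), f gets
   rotated by the unit complex number u.  In particular the u such that
   [transport f0 f0 u] form the holonomy group based at f0. *)
Inductive transport : tile Y -> C -> Prop :=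
| transport_base : transport f0 1
| transport_cross f u i g v j : transport f u -> glued f i g j ->
    `|v| = 1 -> translation_match f u i g v j -> transport g v.

(* The connected cover attached to the kernel of the holonomy homomorphism: two
   paths from f0 to f lead to the same tile over f iff they rotate f equally,
   i.e. iff they differ by a loop with trivial holonomy.  The tiles over f are
   the k copies of f rotated by a coset of the holonomy group (of order k), and
   sides are glued by translations. *)
Definition translation_cover : tiled_surface := {|
  tile := {fu : tile Y * C | transport fu.1 fu.2};
  corners := fun a => [seq (sval a).2 * z | z <- corners (sval a).1];
  glued := fun a i b j =>
    glued (sval a).1 i (sval b).1 j /\
    translation_match (sval a).1 (sval a).2 i (sval b).1 (sval b).2 j |}.

End TranslationCover.

Definition regular_polygon (p : nat) (l : R) : seq C :=
  let r := l / (2 * sin (pi / p%:R)) in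
  let zeta : C := (cos (2 * pi / p%:R) +i* sin (2 * pi / p%:R))%C in
  [seq r *: zeta ^+ m | m <- iota 0 p].

Section Polyhedra.
Local Notation V := 'rV[R]_3.

Definition dot (x y : V) : R := \sum_i x 0 i * y 0 i.

(* The canonical norm of the type 'rV[R]_3 is the sup norm. *)
Definition euclid (x : V) : R := Num.sqrt (dot x x).

Definition boundary (A : set V) : set V := closure A `\` interior A.

Inductive lattice (G : set V) : set V :=
| lattice0 : lattice G 0
| latticeD v g : lattice G v -> G g -> lattice G (v + g)
| latticeB v g : lattice G v -> G g -> lattice G (v - g).

Definition shift (v : V) (s : seq V) : seq V := [seq x + v | x <- s].

Definition translates (L : set V) (A : set V) : set V :=
  [set x | exists2 v, L v & A (x - v)].

Definition orbit_mod (L : set V) (s : seq V) : set (seq V) :=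
  [set s' | exists2 v, L v & exists i, s' = rot i (shift v s)].

(* The quotient by the group L of translations of the boundary Pi of the union
   of the L-translates of cell.  The set faces consists of the faces of the
   polyhedra making up cell, as vertex cycles that are counterclockwise seen
   from outside; those contained in Pi tile it (modulo L).  A tile of the
   quotient is the set of all its vertex cycles, up to L; an arbitrary one of
   them decides how the tile is drawn in the plane. *)
Section Quotient.
Variables (L : set V) (cell : set V) (faces : set (seq V)).

Definition quotient_tile : Type :=
  {A : set (seq V) | exists s, [/\ faces s,
     hull s `<=` boundary (translates L cell) & A = orbit_mod L s]}.

Definition vertex_cycle (A : quotient_tile) : seq V := xget [::] (sval A).

Definition quotient_surface : tiled_surface := {|
  tile := quotient_tile;
  corners := fun A => let s := vertex_cycle A in
    regular_polygon (size s) (euclid ((side s 0).2 - (side s 0).1));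
  glued := fun A i B j => let s := vertex_cycle A in let t := vertex_cycle B in
    [/\ (i < size s)%N, (j < size t)%N &
        exists2 v, L v & (side s i).1 = (side t j).2 + v /\
                         (side s i).2 = (side t j).1 + v] |}.

End Quotient.

Definition basis (i : 'I_3) : V := delta_mx 0 i.
Local Notation e := basis.

(* The vertices of the face of the octahedron in the octant of signs a, b, c. *)
Definition octahedron_face (a b c : bool) : seq V :=
  let s := [:: (-1) ^+ a *: e 0; (-1) ^+ b *: e 1; (-1) ^+ c *: e 2] in
  if a (+) b (+) c then rev s else s.

Definition octahedron_faces : set (seq V) :=
  [set s | exists a b c, s = octahedron_face a b c].

Definition solid_octahedron : set V :=
  hull [:: e 0; - e 0; e 1; - e 1; e 2; - e 2].

Definition octahedron : tiled_surface :=
  quotient_surface [set 0] solid_octahedron octahedron_faces.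

Definition sign_vector (a b c : bool) : V :=
  (-1) ^+ a *: e 0 + (-1) ^+ b *: e 1 + (-1) ^+ c *: e 2.

(* The reflection in the plane of octahedron_face a b c, which is
   [set x | dot x (sign_vector a b c) = 1]. *)
Definition face_reflection (a b c : bool) (x : V) : V :=
  let n := sign_vector a b c in x - (2 * (dot x n - 1) / dot n n) *: n.

Definition octa8_lattice : set V :=
  lattice [set g | exists a b c, g = (4 / 3) *: sign_vector a b c].

Definition octa8_cell : set V :=
  solid_octahedron `|`
  [set x | exists a b c, (face_reflection a b c @` solid_octahedron) x].

(* Reflections reverse orientation, hence rev. *)
Definition octa8_faces : set (seq V) :=
  octahedron_faces `|`
  [set s | exists a b c, exists2 s', octahedron_faces s' &
     s = rev (map (face_reflection a b c) s')].

Definition octa8_quotient : tiled_surface :=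
  quotient_surface octa8_lattice octa8_cell octa8_faces.

(* The face x_i = b of the unit cube; indices are taken modulo 3. *)
Definition cube_face (i : 'I_3) (b : bool) : seq V :=
  let o := b%:R *: e i in
  let s := [:: o; o + e (i + 1); o + e (i + 1) + e (i + 2); o + e (i + 2)] in
  if b then s else rev s.

Definition cube_faces : set (seq V) := [set s | exists i b, s = cube_face i b].

Definition solid_cube : set V := [set x | forall i, 0 <= x 0 i <= 1].

Definition cube : tiled_surface :=
  quotient_surface [set 0] solid_cube cube_faces.

Definition mucube_lattice : set V :=
  lattice [set g | exists i, g = 2 *: e i].

Definition mucube_cell : set V :=
  solid_cube `|` [set x | exists i, solid_cube (x - e i)].

Definition mucube_faces : set (seq V) :=
  cube_faces `|`
  [set s | exists i, exists2 s', cube_faces s' & s = shift (e i) s'].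

Definition mucube_quotient : tiled_surface :=
  quotient_surface mucube_lattice mucube_cell mucube_faces.

End Polyhedra.

End TiledSurfaces.

(* Main.v *)
Require Import Defs.
From mathcomp Require Import ring lra zify.

(** Both statements are instances of one fact about coverings.  Let Z and Y be
    surfaces tiled by copies of one regular polygon, with Y connected, and let
    Z -> Y be a map of tiles that respects the gluing; it is a covering away
    from the vertices.  The translation cover of Y is the cover attached to the
    loops of trivial holonomy, so it covers Z as soon as all these loops lift to
    closed loops of Z, and then it is the translation cover of Z as well.  The
    condition on loops says that two tiles of Z over the same tile of Y that are
    developed with the same rotation coincide; this is isometric_covers.

    For Octa-8 the covering comes from the vertices.  Modulo the lattice every
    vertex of Octa-8 is congruent to exactly one vertex of the octahedron O, and
    sending it to the antipode of that vertex sends the triangles of Octa-8 to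
    the faces of O.  Indeed a triangle of Octa-8 is the mirror image, in the
    plane of a face F, of a face G other than F and its opposite, and this
    reflection fixes the vertices of F and moves the other three by a lattice
    vector; so the triangle goes to the opposite of G.  The reflection reverses
    the orientation and the antipode restores it.  The covering has degree 3.
    For Mucube the same construction with the lattice of even vectors and the
    central symmetry of the unit cube gives a covering of degree 2 of the cube.

    The condition on loops is verified with an argument of the square of the
    direction of an edge.  An edge from x to y, with images x' and y', gets a
    number q modulo p (the number of sides of the tiles) which does not depend
    on the orientation of the edge, is invariant under the lattice, and
    increases by 2 from a side of a tile to the next one: the squared
    direction of the side in any development is then a constant times
    exp(2 i pi q / p).  For Octa-8, q = det (x', y', y - x) up to normalization;
    for Mucube, q is the scalar product of y - x and y' - x'.  The triple
    (x', y', q) determines the edge modulo the lattice, hence the tile on its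
    left; this gives the condition.

    These properties are finite statements about integer vectors, decided by
    computation (octa8_covering_test, mucube_covering_test) and transferred to
    the surfaces by isometric_models.  What needs geometry is to identify
    the faces that lie on the boundary of the periodic solids
    (octahedron_modelled, octa8_modelled, cube_modelled, mucube_modelled).  The
    centre of a face that does not is an interior point of the solid; from a
    face that does, the segments to a suitable point outside leave the solid
    at once. *)

Set Implicit Arguments.
Unset Strict Implicit.
Unset Printing Implicit Defensive.

Import Order.TTheory GRing.Theory Num.Theory.
Import numFieldNormedType.Exports.

Local Open Scope classical_set_scope.
Local Open Scope ring_scope.

(** * Isometries of tiled surfaces *)

Section TileMaps.
Variable R : realType.
Local Notation C := (Rcomplex R).

Lemma Rcomplex_normM (x y : C) : `|x * y : C| = `|x| * `|y|.
Proof. exact: Normc.normcM. Qed.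

Lemma Rcomplex_normV (x : C) : `|x^-1 : C| = `|x|^-1.
Proof. exact: Normc.normcV. Qed.

Lemma Rcomplex_norm1 : `|1 : C| = 1.
Proof. exact: Normc.normc1. Qed.

Lemma Rcomplex_scaleAr (r : R) (x y : C) : r *: (x * y) = x * (r *: y).
Proof. by rewrite mulrC scalerAl mulrC. Qed.

Lemma unit_neq0 (c : C) : `|c| = 1 -> c != 0.
Proof. by move=> c1; rewrite -normr_eq0 c1 oner_eq0. Qed.

Definition move_point (X X' : tiled_surface R) (h : tile X -> tile X') (c : C)
    (x : tile X * C) : tile X' * C := (h x.1, c * x.2).

Section OneWay.
Variables (X X' : tiled_surface R) (h : tile X -> tile X') (c : C).
Hypothesis c1 : `|c| = 1.
Hypothesis in_tile_move : forall a z, in_tile a z -> in_tile (h a) (c * z).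
Hypothesis sewn_move : forall x y,
  sewn x y -> sewn (move_point h c x) (move_point h c y).

Lemma same_point_move x y :
  same_point x y -> same_point (move_point h c x) (move_point h c y).
Proof.
elim=> {x y} [x y /sewn_move|x|x y _|x y z _ xy _ yz].
- exact: rst_step.
- exact: rst_refl.
- exact: rst_sym.
- exact: rst_trans xy yz.
Qed.

Lemma broken_line_move x y l :
  broken_line x y l -> broken_line (move_point h c x) (move_point h c y) l.
Proof.
elim=> {x y l} [x|f z z' y l fz fz' _ IH|x x' y l xx' _ IH].
- exact: broken_nil.
- have -> : `|z' - z| = `|c * z' - c * z : C|.
    by rewrite -mulrBr Rcomplex_normM c1 mul1r.
  by apply: broken_seg IH; exact: in_tile_move.
- exact: broken_jump (same_point_move xx') IH.
Qed.

End OneWay.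

(** The intrinsic distance only depends on the tiles as subsets of the plane,
    on the sewing and on lengths. One rotation c for all tiles is enough: on
    translation covers a map is determined up to a global rotation. *)
Lemma isometric_tile_bijection (X X' : tiled_surface R)
    (h : tile X -> tile X') (c : C) :
  bijective h -> `|c| = 1 ->
  (forall a z, in_tile a z <-> in_tile (h a) (c * z)) ->
  (forall x y, sewn x y <-> sewn (move_point h c x) (move_point h c y)) ->
  isometric X X'.
Proof.
case=> h' hK h'K c1 in_h sewn_h.
have c0 := unit_neq0 c1.
have c'1 : `|c^-1 : C| = 1 by rewrite Rcomplex_normV c1 invr1.
have mK : cancel (move_point h c) (move_point h' c^-1).
  by case=> a z; rewrite /move_point /= hK mulKf.
have m'K : cancel (move_point h' c^-1) (move_point h c).
  by case=> a z; rewrite /move_point /= h'K mulVKf.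
have in_h' a z : in_tile a z -> in_tile (h' a) (c^-1 * z).
  by move=> az; apply/in_h; rewrite h'K mulVKf.
have sewn_h' x y : sewn x y -> sewn (move_point h' c^-1 x) (move_point h' c^-1 y).
  by move=> xy; apply/sewn_h; rewrite !m'K.
have in_hr a z : in_tile a z -> in_tile (h a) (c * z) by move/in_h.
have sewn_hr x y : sewn x y -> sewn (move_point h c x) (move_point h c y).
  by move/sewn_h.
have same_h x y : same_point x y <-> same_point (move_point h c x) (move_point h c y).
  split; first exact: same_point_move.
  by move=> /(same_point_move sewn_h'); rewrite !mK.
have line_h x y l :
    broken_line x y l <-> broken_line (move_point h c x) (move_point h c y) l.
  split; first exact: broken_line_move.
  by move=> /(broken_line_move c'1 in_h' sewn_h'); rewrite !mK.
have class_h x : move_point h c @` [set y | same_point x y] =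
                 [set y | same_point (move_point h c x) y].
  apply/seteqP; split=> [_ [y xy <-]|y /= xy]; first exact/same_h.
  by exists (move_point h' c^-1 y); rewrite ?m'K //=; apply/same_h; rewrite m'K.
exists (fun A => move_point h c @` A); split.
  split.
  - by move=> _ [x xin ->]; exists (move_point h c x); [exact: in_hr|exact: class_h].
  - move=> A B _ _ eqAB; apply/seteqP; split=> x xA.
      have : (move_point h c @` B) (move_point h c x) by rewrite -eqAB; exists x.
      by case=> y By /(can_inj mK) <-.
    have : (move_point h c @` A) (move_point h c x) by rewrite eqAB; exists x.
    by case=> y By /(can_inj mK) <-.
  - move=> _ [x xin ->]; exists [set y | same_point (move_point h' c^-1 x) y].
      by exists (move_point h' c^-1 x) => //; exact: in_h'.
    by rewrite class_h m'K.
move=> A B _ _; rewrite /intrinsic_dist; congr (ereal_inf (_ @` _)).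
apply/seteqP; split=> l /= [x [y [xA yB xyl]]].
  case: xA xyl => {}x xA <-; case: yB => {}y yB <- xyl.
  by exists x, y; split=> //; exact/line_h.
exists (move_point h c x), (move_point h c y).
by split; [exists x|exists y|exact/line_h].
Qed.

Lemma isometric_sym (X Y : tiled_surface R) : isometric X Y -> isometric Y X.
Proof.
case=> phi [[phi_fun phi_inj phi_surj] phi_dist].
have /choice [psi psiP] (B : set (tile Y * C)) :
    exists A, points B -> points A /\ phi A = B.
  have [/phi_surj[A pA AB]|nB] := pselect (points B); first by exists A.
  by exists set0.
exists psi; split; first split.
- by move=> B /psiP[].
- move=> A B /set_mem/psiP[_ AE] /set_mem/psiP[_ BE] AB.
  by rewrite -AE -BE AB.
- move=> A pA; have [pB BE] := psiP _ (phi_fun _ pA).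
  exists (phi A); first exact: phi_fun.
  by apply: phi_inj => //; exact/mem_set.
- move=> A B /psiP[pA AE] /psiP[pB BE].
  by rewrite -[in RHS]AE -[in RHS]BE phi_dist.
Qed.

End TileMaps.

(** * Convex hulls and regular polygons *)

Section Hull.
Variables (R : realType) (V : lmodType R).
Implicit Types (s t : seq V) (x : V).

Lemma mem_hull s x : x \in s -> hull s x.
Proof.
move=> xs; have xi : (index x s < size s)%N by rewrite index_mem.
exists (fun i => (i == Ordinal xi)%:R); split=> [i||].
- by rewrite ler0n.
- by rewrite (bigD1 (Ordinal xi)) //= eqxx big1 ?addr0 // => i /negPf->.
- rewrite (bigD1 (Ordinal xi)) //= eqxx big1 => [|i /negPf->].
    by rewrite scale1r addr0 nth_index.
  by rewrite scale0r.
Qed.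

Lemma hull_min s t : (forall x, x \in s -> hull t x) -> hull s `<=` hull t.
Proof.
move=> st x [w [w0 w1 ->]].
have /choice [a aP] (i : 'I_(size s)) : exists a : 'I_(size t) -> R,
    [/\ forall j, 0 <= a j, \sum_j a j = 1 & s`_i = \sum_j a j *: t`_j].
  exact/st/mem_nth.
exists (fun j => \sum_i w i * a i j); split=> [j||].
- by apply: sumr_ge0 => i _; rewrite mulr_ge0 //; have [] := aP i.
- rewrite exchange_big /= -w1; apply: eq_bigr => i _.
  by rewrite -mulr_sumr; have [_ -> _] := aP i; rewrite mulr1.
- under [RHS]eq_bigr do rewrite scaler_suml.
  rewrite exchange_big /=; apply: eq_bigr => i _.
  have [_ _ ->] := aP i; rewrite scaler_sumr.
  by apply: eq_bigr => j _; rewrite scalerA.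
Qed.

Lemma hull_sub s t : {subset s <= t} -> hull s `<=` hull t.
Proof. by move=> st; apply: hull_min => x /st; exact: mem_hull. Qed.

Lemma hull_linear (W : lmodType R) (f : V -> W) s x :
  linear f -> hull s x -> hull (map f s) (f x).
Proof.
move=> flin [w [w0 w1 ->]].
have sz := size_map f s.
have f0 : f 0 = 0 by have := flin (-1) 0 0; rewrite scaler0 addr0 scaleN1r addNr.
exists (fun i => w (cast_ord sz i)); split=> [//||].
- rewrite -w1; apply: esym; apply: (reindex (cast_ord sz)).
  by exists (cast_ord (esym sz)) => i _; rewrite (cast_ordK, cast_ordKV).
- rewrite (reindex (cast_ord sz)); last first.
    by exists (cast_ord (esym sz)) => i _; rewrite (cast_ordK, cast_ordKV).
  elim/big_rec2: _ => [//|i _ y _ <-]; rewrite flin (nth_map 0) //.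
  exact: (ltn_ord (cast_ord sz i)).
Qed.

End Hull.

Section RegularPolygon.
Variables (R : realType) (p : nat).
Hypothesis p_gt1 : (1 < p)%N.
Local Notation C := (Rcomplex R).

Definition zeta : C := (cos (2 * pi / p%:R) +i* sin (2 * pi / p%:R))%C.

Lemma zetaX m :
  zeta ^+ m = (cos (m%:R * (2 * pi / p%:R)) +i* sin (m%:R * (2 * pi / p%:R)))%C.
Proof.
rewrite /zeta; set a := 2 * pi / p%:R.
elim: m => [|m IH]; first by rewrite mul0r cos0 sin0.
have -> : m.+1%:R * a = a + m%:R * a by rewrite -[m.+1%:R]natr1 mulrDl mul1r addrC.
rewrite exprS IH cosD sinD; congr (_ +i* _)%C.
by rewrite addrC.
Qed.

Lemma pi_frac_gt0 m : (0 < m < p)%N -> 0 < (m%:R * (pi / p%:R) : R) < pi.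
Proof.
case/andP=> m0 mp; have p0 : 0 < p%:R :> R by rewrite ltr0n (ltn_trans m0).
rewrite mulr_gt0 ?ltr0n ?divr_gt0 ?pi_gt0 //= mulrA ltr_pdivrMr //.
by rewrite mulrC ltr_pM2l ?pi_gt0 // ltr_nat.
Qed.

(** A smaller power zeta ^+ m equal to 1 would give cos (2 a) = 1, hence sin a
    = 0, for an angle a strictly between 0 and pi. *)
Lemma zeta_prim : p.-primitive_root zeta.
Proof.
have p0 : (0 < p)%N by apply: ltn_trans p_gt1.
have zp1 : zeta ^+ p = 1.
  rewrite zetaX mulrC divfK ?pnatr_eq0 -?lt0n // mulrC mulr_natr.
  by rewrite cos2pi sin2pi.
have [m mprim mdvd] := prim_order_exists p0 zp1.
case/boolP: (m == p) => [/eqP <- //|mp].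
have m0 := prim_order_gt0 mprim.
have mltp : (0 < m < p)%N by rewrite m0 ltn_neqAle mp dvdn_leq.
have := prim_expr_order mprim; rewrite zetaX.
have -> : m%:R * (2 * pi / p%:R) = (m%:R * (pi / p%:R)) *+ 2 :> R.
  by rewrite -mulr_natl; ring.
set a := m%:R * _ => za1.
have cos2a : cos (a *+ 2) = 1 := congr1 (@complex.Re R) za1.
have := sin_gt0_pi (pi_frac_gt0 mltp).
have := cos2Dsin2 a; move: cos2a; rewrite cos_mulr2n -/a.
by move: (cos a) (sin a) => c s; nra.
Qed.

Lemma zeta_norm : `|zeta : C| = 1.
Proof. by rewrite /zeta /Num.norm /= cos2Dsin2 sqrtr1. Qed.

Lemma zeta_neq0 : zeta != 0.
Proof. exact: unit_neq0 zeta_norm. Qed.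

Lemma zetaX_norm m : `|zeta ^+ m : C| = 1.
Proof.
elim: m => [|m IH]; first exact: Rcomplex_norm1.
by rewrite exprS Rcomplex_normM IH zeta_norm mulr1.
Qed.

Lemma zeta_mod m : zeta ^+ (m %% p) = zeta ^+ m.
Proof. exact: prim_expr_mod zeta_prim _. Qed.

End RegularPolygon.

(** * Translation covers of coverings *)

Section Transport.
Variables (R : realType) (Y : tiled_surface R).
Local Notation C := (Rcomplex R).
Implicit Types (f g h : tile Y) (u v : C).

Lemma transport_norm f g u : transport f g u -> `|u| = 1.
Proof. by case=> *; first exact: Rcomplex_norm1. Qed.

Lemma translation_matchM f u i g v j w :
  translation_match f u i g v j -> translation_match f (w * u) i g (w * v) j.
Proof. by rewrite /translation_match -!mulrA => ->; rewrite mulrN. Qed.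

Lemma translation_match_sym f u i g v j :
  translation_match f u i g v j -> translation_match g v j f u i.
Proof. by rewrite /translation_match => ->; rewrite opprK. Qed.

Lemma transport_trans f g h u v :
  transport f g u -> transport g h v -> transport f h (u * v).
Proof.
move=> fgu; elim=> {h v} [|g' v i h w j _ IH glu w1 vw]; first by rewrite mulr1.
apply: transport_cross IH glu _ (translation_matchM _ vw).
by rewrite Rcomplex_normM w1 mulr1 (transport_norm fgu).
Qed.

Hypothesis glued_sym : forall f i g j, glued f i g j -> glued g j f i.

(** A path of tiles can be followed backwards because gluing is symmetric;
    this makes the holonomy groups at two base tiles comparable. *)
Lemma transport_sym f g u : transport f g u -> transport g f u^-1.
Proof.
elim=> {g u} [|g u i h v j fgu IH glu v1 uv].
  by rewrite invr1; exact: transport_base.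
have u0 := unit_neq0 (transport_norm fgu).
have v0 := unit_neq0 v1.
have -> : v^-1 = (v^-1 * u) * u^-1 by rewrite mulfK.
apply: transport_trans IH.
apply: (transport_cross (transport_base h) (glued_sym glu)).
  by rewrite Rcomplex_normM Rcomplex_normV v1 invr1 mul1r (transport_norm fgu).
have := translation_matchM v^-1 (translation_match_sym uv).
by rewrite mulVf.
Qed.

End Transport.

Section RegularTilings.
Variables (R : realType) (p : nat) (l : R).
Hypotheses (p_gt1 : (1 < p)%N) (l_gt0 : 0 < l).
Local Notation C := (Rcomplex R).
Local Notation zeta := (zeta R p).
Local Notation r := (l / (2 * sin (pi / p%:R))).

Definition regular_tiling (Y : tiled_surface R) : Prop :=
  (forall f : tile Y, corners f = regular_polygon p l) /\
  (forall (f : tile Y) i g j, glued f i g j -> (i < p)%N /\ (j < p)%N).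

(** The corners of a regular polygon turned by u; the index may exceed the
    number of corners, which makes cyclic renumberings of the sides additive. *)
Definition node (u : C) (i : nat) : C := u * (r *: zeta ^+ i).

Lemma node_mod u i : node u (i %% p)%N = node u i.
Proof. by rewrite /node zeta_mod. Qed.

Lemma nodeM c u i : c * node u i = node (c * u) i.
Proof. by rewrite /node mulrA. Qed.

Lemma nodeD u k i : node (u * zeta ^- k) (i + k) = node u i.
Proof.
rewrite /node -!Rcomplex_scaleAr; congr (_ *: _).
rewrite exprD mulrA [u * _ * _]mulrAC mulfVK // expf_neq0 //.
exact: zeta_neq0.
Qed.

Lemma regular_polygonE u : [seq u * z | z <- regular_polygon p l] =
  [seq node u m | m <- iota 0 p].
Proof. by rewrite -map_comp. Qed.

Lemma nth_nodes u i : (i < p)%N -> [seq node u m | m <- iota 0 p]`_i = node u i.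
Proof. by move=> ip; rewrite (nth_map 0%N) ?size_iota // nth_iota. Qed.

Lemma side_nodes u i : (i < p)%N ->
  side [seq node u m | m <- iota 0 p] i = (node u i, node u i.+1).
Proof.
move=> ip; rewrite /side size_map size_iota !nth_nodes ?node_mod //.
by rewrite ltn_mod (ltn_trans _ p_gt1).
Qed.

Section OneSurface.
Variable Y : tiled_surface R.
Hypothesis Yreg : regular_tiling Y.

(** All the sides of a regular polygon have directions proportional to powers
    of zeta, with one nonzero factor, which cancels. *)
Lemma translation_matchE (f g : tile Y) u v i j : (i < p)%N -> (j < p)%N ->
  translation_match f u i g v j <-> u * zeta ^+ i = - (v * zeta ^+ j).
Proof.
move=> ip jp; pose D : C := r *: (zeta - 1).
have D0 : D != 0.
  rewrite scaler_eq0 negb_or subr_eq0; apply/andP; split.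
    rewrite mulf_neq0 ?gt_eqF // invr_gt0 mulr_gt0 // sin_gt0_pi //.
    by have := @pi_frac_gt0 R p 1; rewrite mul1r; exact.
  have := prim_order_gt0 (zeta_prim R p_gt1).
  have := eq_prim_root_expr (zeta_prim R p_gt1) 1 0.
  by rewrite expr1 expr0 => ->; rewrite eqn_mod_dvd // subn0 dvdn1 gtn_eqF.
have dirE h m : (m < p)%N -> direction (h : tile Y) m = zeta ^+ m * D.
  move=> mp; rewrite /direction (proj1 Yreg).
  have -> : regular_polygon p l = [seq node 1 m | m <- iota 0 p].
    by rewrite -regular_polygonE -[LHS]map_id; apply: eq_map => z; rewrite mul1r.
  rewrite side_nodes //= /node !mul1r -scalerBr /D -Rcomplex_scaleAr.
  by rewrite exprSr mulrBr mulr1.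
rewrite /translation_match !dirE // !mulrA -mulNr.
by split=> [/(mulIf D0)|->].
Qed.

Lemma transport_across (f g h : tile Y) u i j :
  transport f g u -> glued g i h j ->
  transport f h (- (u * zeta ^+ i * zeta ^- j)).
Proof.
move=> fgu glu; have [ip jp] := proj2 Yreg _ _ _ _ glu.
apply: (transport_cross fgu glu).
  rewrite normrN !Rcomplex_normM Rcomplex_normV !zetaX_norm // invr1.
  by rewrite (transport_norm fgu) !mulr1.
apply/translation_matchE => //; rewrite mulNr opprK mulfVK //.
by rewrite expf_neq0 // zeta_neq0.
Qed.

End OneSurface.

Section Covering.
Variables Y Z : tiled_surface R.
Hypotheses (Yreg : regular_tiling Y) (Zreg : regular_tiling Z).
(** Side i of f lies over side i + k f of pr f. *)
Variables (pr : tile Z -> tile Y) (k : tile Z -> nat).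
Hypothesis Y_sym : forall (f : tile Y) i g j, glued f i g j -> glued g j f i.
Hypothesis Y_conn : forall f g : tile Y, exists u, transport f g u.
Hypothesis Y_unique : forall (f : tile Y) i g j g' j',
  glued f i g j -> glued f i g' j' -> g = g' /\ j = j'.
Hypothesis Z_closed : forall (f : tile Z) i, (i < p)%N ->
  exists g j, glued f i g j.
Hypothesis pr_glued : forall (f : tile Z) i g j, glued f i g j ->
  glued (pr f) ((i + k f) %% p)%N (pr g) ((j + k g) %% p)%N.

(** Up to a constant, zeta ^+ q f i is the square of the direction of side i
    of f in a development. *)
Variable q : tile Z -> nat -> nat.
Hypothesis q_glued : forall (f : tile Z) i g j, glued f i g j ->
  q f i = q g j %[mod p].
Hypothesis q_next : forall (f : tile Z) i, (i < p)%N ->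
  q f (i.+1 %% p)%N = q f i + 2 %[mod p].
Hypothesis q_sep : forall (f g : tile Z) i j, (i < p)%N -> (j < p)%N ->
  pr f = pr g -> i + k f = j + k g %[mod p] -> q f i = q g j %[mod p] -> f = g.

Let p_gt0 : (0 < p)%N := ltn_trans (ltn0Sn 0) p_gt1.
Let z0 i : zeta ^+ i != 0. Proof. by rewrite expf_neq0 // zeta_neq0. Qed.

Lemma zeta_eq i j : (zeta ^+ i == zeta ^+ j) = (i == j %[mod p]).
Proof. exact: eq_prim_root_expr (zeta_prim R p_gt1) i j. Qed.

Lemma q_shift (f : tile Z) i : (i < p)%N -> q f i = q f 0 + 2 * i %[mod p].
Proof.
elim: i => [|i IH] ip; first by rewrite addn0.
have := @q_next f i (ltnW ip); rewrite (modn_small ip) => ->.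
by rewrite -modnDml IH ?(ltnW ip) // modnDml; congr (_ %% _)%N; lia.
Qed.

(** The squared direction of a side, in any development along a path of tiles,
    is given by q up to a constant: crossing an edge reverses the direction,
    and moving to the next side multiplies its square by zeta ^+ 2, as q
    prescribes. *)
Lemma transport_square (f g : tile Z) v i : transport f g v -> (i < p)%N ->
  (v * zeta ^+ i) ^+ 2 * zeta ^+ q f 0 = zeta ^+ q g i.
Proof.
have step (h : tile Z) m : (m < p)%N -> zeta ^+ q h m = zeta ^+ q h 0 * zeta ^+ m ^+ 2.
  move=> mp; rewrite -exprM -exprD; apply/eqP; rewrite zeta_eq q_shift //.
  by rewrite mulnC.
move=> tr; elim: tr i => {g v} [|g u m h v j _ IH glu v1 uv] i ip.
  by rewrite mul1r mulrC -step.
have [mp jp] := proj2 Zreg _ _ _ _ glu.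
have {}uv := (translation_matchE Zreg _ _ _ _ mp jp).1 uv.
have := IH _ mp; rewrite uv sqrrN.
have -> : zeta ^+ q g m = zeta ^+ q h j by apply/eqP; rewrite zeta_eq (q_glued glu).
rewrite (step h j) // exprMn mulrAC => /(mulIf (expf_neq0 2 (z0 j))) E.
by rewrite exprMn mulrAC E -step.
Qed.

(** Since every side of Z is glued to some tile, a crossing in Y from the
    image of f lifts to a crossing from f, and uniqueness of the neighbour in
    Y shows that it lies over the given one. *)
Lemma lift_glued (f : tile Z) i g j : glued (pr f) i g j ->
  exists m h n, [/\ glued f m h n, pr h = g, i = ((m + k f) %% p)%N &
    j = ((n + k h) %% p)%N].
Proof.
move=> glu; have [ip jp] := proj2 Yreg _ _ _ _ glu.
(* The side of f over side i; the truncated subtraction stands for i - k f. *)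
pose m := ((i + (p - k f %% p)) %% p)%N.
have mp : (m < p)%N by rewrite ltn_mod.
have im : i = ((m + k f) %% p)%N.
  rewrite modnDml -addnA -modnDmr -[((_ - _ + _) %% p)%N]modnDmr subnK.
    by rewrite modnn addn0 modn_small.
  by rewrite ltnW // ltn_mod.
have [h [n fh]] := Z_closed f mp.
exists m, h, n; have := pr_glued fh; rewrite -im => glu'.
by have [-> ->] := Y_unique glu glu'; split.
Qed.

Section Basepoints.
Variables (f0 : tile Y) (g0 : tile Z) (w : C).
Hypothesis f0_g0 : transport f0 (pr g0) w.

Let w0 : w != 0 := unit_neq0 (transport_norm f0_g0).
Let c : C := w * zeta ^+ k g0.
Let turn (g : tile Z) (v : C) : C := c * v * zeta ^- k g.

Lemma turnX (g : tile Z) v i :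
  turn g v * zeta ^+ (i + k g) = c * (v * zeta ^+ i).
Proof. by rewrite /turn addnC exprD -!mulrA mulKf. Qed.

(** Translation matching is insensitive to the renumbering of the sides,
    because turn compensates the shift k by a rotation. *)
Lemma turn_match (g h : tile Z) u v i j :
  turn g u * zeta ^+ (i + k g) = - (turn h v * zeta ^+ (j + k h)) <->
  u * zeta ^+ i = - (v * zeta ^+ j).
Proof.
rewrite !turnX -mulrN; split=> [|->] //.
exact: (mulfI (mulf_neq0 w0 (z0 _))).
Qed.

Lemma turn_base : turn g0 1 = w.
Proof. by rewrite /turn /c mulr1 mulfK. Qed.

Lemma transport_push g v : transport g0 g v -> transport f0 (pr g) (turn g v).
Proof.
elim=> {g v} [|g u i h v j _ IH glu v1 uv]; first by rewrite turn_base.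
have [ip jp] := proj2 Zreg _ _ _ _ glu.
apply: (transport_cross IH (pr_glued glu)).
  rewrite /turn /c !Rcomplex_normM Rcomplex_normV !zetaX_norm // v1.
  by rewrite (transport_norm f0_g0) invr1 !mulr1.
apply/(translation_matchE Yreg); rewrite ?ltn_mod // !zeta_mod //.
by apply/turn_match; exact: ((translation_matchE Zreg _ _ _ _ ip jp).1 uv).
Qed.

Lemma lift_match (g : tile Z) v i (f : tile Y) u j : transport g0 g v ->
  glued (pr g) i f j -> translation_match (pr g) (turn g v) i f u j ->
  exists h v' m n, [/\ transport g0 h v', glued g m h n,
    translation_match g v m h v' n, pr h = f & turn h v' = u].
Proof.
move=> tr glu; have [m [h [n [gh <- -> ->]]]] := lift_glued glu => uv.
have [mp np] := proj2 Zreg _ _ _ _ gh.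
have mod_lt n' : (n' %% p < p)%N by rewrite ltn_mod.
have {}uv := (translation_matchE Yreg _ _ _ _ (mod_lt _) (mod_lt _)).1 uv.
have trh := transport_across Zreg tr gh.
set v' := - _ in trh; exists h, v', m, n.
have vv' : v * zeta ^+ m = - (v' * zeta ^+ n).
  by rewrite /v' mulNr opprK mulfVK.
split=> //; first exact/(translation_matchE Zreg).
have := (turn_match g h _ _ _ _).2 vv'; rewrite -(zeta_mod _ p_gt1 (m + _)) uv.
by rewrite zeta_mod // => /oppr_inj/(mulIf (z0 _)) ->.
Qed.

Lemma transport_lift f u : transport f0 f u ->
  exists g v, [/\ transport g0 g v, pr g = f & turn g v = u].
Proof.
move=> /(transport_trans (transport_sym Y_sym f0_g0)).
have -> : u = w * (w^-1 * u) by rewrite mulVKf.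
rewrite mulKf //; set t := w^-1 * u; elim=> {f t u} [|f t i h s j _ IH glu s1 ts].
  by exists g0, 1; rewrite turn_base mulr1; split=> //; exact: transport_base.
have [g [v [tr prg gv]]] := IH.
move: glu; rewrite -prg => glu.
have uv : translation_match (pr g) (turn g v) i h (w * s) j.
  by rewrite gv prg; exact: translation_matchM.
by have [g' [v' [m [n [? _ _ <- <-]]]]] := lift_match tr glu uv; exists g', v'.
Qed.

(** Two tiles of Z over the same tile of Y with the same rotation have, after
    renumbering, the same squared directions; then q agrees and separates
    them. *)
Lemma turn_inj g v h v' : transport g0 g v -> transport g0 h v' ->
  pr g = pr h -> turn g v = turn h v' -> g = h /\ v = v'.
Proof.
move=> trg trh gh; rewrite /turn -![c * _ * _]mulrA.
move=> /(mulfI (mulf_neq0 w0 (z0 _))) vv'.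
(* The sides of g and h over side 0 of their common image. *)
pose i (g1 : tile Z) := ((p - k g1 %% p) %% p)%N.
have ip g1 : (i g1 < p)%N by rewrite ltn_mod.
have ik g1 : (i g1 + k g1 = 0 %[mod p])%N.
  rewrite modnDml -modnDmr subnK ?modnn ?mod0n //.
  by rewrite ltnW // ltn_mod.
have zi g1 : zeta ^+ i g1 = zeta ^- k g1.
  apply: (mulIf (z0 (k g1))); rewrite mulVf // -exprD -(expr0 zeta).
  by apply/eqP; rewrite zeta_eq ik.
have E : g = h.
  apply: (@q_sep g h _ _ (ip g) (ip h) gh); first by rewrite !ik.
  apply/eqP; rewrite -zeta_eq -(transport_square trg (ip g)).
  by rewrite -(transport_square trh (ip h)) !zi vv'.
by split=> //; move: vv'; rewrite E => /(mulIf (invr_neq0 (z0 _))).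
Qed.

Definition push_tile (a : tile (translation_cover g0)) :
    tile (translation_cover f0) :=
  exist _ (pr (sval a).1, turn (sval a).1 (sval a).2) (transport_push (svalP a)).

Lemma push_tile_inj : injective push_tile.
Proof.
case=> [[g v] gv] [[h v'] hv'] /(congr1 sval) /= [gh vv'].
apply: eq_exist => /=.
by have [-> ->] : g = h /\ v = v' := turn_inj gv hv' gh vv'.
Qed.

Lemma push_tile_surj b : exists a, push_tile a = b.
Proof.
case: b => [[f u] fu]; have [g [v [gv fE uE]]] := transport_lift fu.
by exists (exist _ (g, v) gv); apply: eq_exist; rewrite /= fE uE.
Qed.

Lemma push_tile_bij : bijective push_tile.
Proof.
have [h hK] := choice push_tile_surj.
by exists h => // a; apply: push_tile_inj; rewrite hK.
Qed.

Lemma scale_norm : `|c| = 1.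
Proof. by rewrite /c Rcomplex_normM (transport_norm f0_g0) zetaX_norm ?mulr1. Qed.

(** The map of tiles push_tile together with the rotation by c carries corners
    to corners, the index being shifted by k. *)
Lemma scale_node g v i : c * node v i = node (turn g v) ((i + k g) %% p).
Proof. by rewrite node_mod /turn nodeD nodeM. Qed.

Lemma scale_nodeS g v i : c * node v i.+1 = node (turn g v) ((i + k g) %% p).+1.
Proof.
by rewrite (scale_node g) -[in RHS]node_mod -[in RHS]addn1 modnDml addn1 addSn.
Qed.

Lemma corners_cover (Y' : tiled_surface R) (h0 : tile Y')
    (a : tile (translation_cover h0)) : regular_tiling Y' ->
  corners a = [seq node (sval a).2 m | m <- iota 0 p].
Proof. by move=> Yr; rewrite /= (proj1 Yr) regular_polygonE. Qed.

Lemma side_cover (Y' : tiled_surface R) (h0 : tile Y')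
    (a : tile (translation_cover h0)) i : regular_tiling Y' -> (i < p)%N ->
  side (corners a) i = (node (sval a).2 i, node (sval a).2 i.+1).
Proof. by move=> Yr ip; rewrite corners_cover // side_nodes. Qed.

Lemma in_tile_push (a : tile (translation_cover g0)) z :
  in_tile a z <-> in_tile (push_tile a) (c * z).
Proof.
rewrite /in_tile !corners_cover //=; case: (sval a) => g v /=.
have c0 : c != 0 := mulf_neq0 w0 (z0 _).
have sub1 : {subset [seq c * z | z <- [seq node v m | m <- iota 0 p]] <=
                    [seq node (turn g v) m | m <- iota 0 p]}.
  move=> _ /mapP[_ /mapP[m mp ->] ->]; rewrite (scale_node g).
  by apply: map_f; rewrite mem_iota ltn_mod.
have sub2 : {subset [seq c^-1 * z | z <- [seq node (turn g v) m | m <- iota 0 p]] <=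
                    [seq node v m | m <- iota 0 p]}.
  move=> _ /mapP[_ /mapP[m mp ->] ->].
  apply/mapP; exists ((m + (p - k g %% p)) %% p)%N.
    by rewrite mem_iota ltn_mod.
  apply: (mulfI c0); rewrite mulVKf // (scale_node g) node_mod.
  rewrite -[LHS]node_mod -[RHS]node_mod; congr node.
  rewrite modnDml -addnA -modnDmr -[((_ - _ + _) %% p)%N]modnDmr subnK.
    by rewrite modnn addn0.
  by rewrite ltnW // ltn_mod.
have mul_linear (d : C) : linear (fun z : C => d * z).
  by move=> t x y; rewrite mulrDr Rcomplex_scaleAr.
split=> [/(hull_linear (mul_linear c)) /(hull_sub sub1) //|].
by move=> /(hull_linear (mul_linear c^-1)) /(hull_sub sub2); rewrite mulKf.
Qed.

Lemma sewn_push (x y : tile (translation_cover g0) * C) :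
  sewn x y <-> sewn (move_point push_tile c x) (move_point push_tile c y).
Proof.
have c0 : c != 0 := mulf_neq0 w0 (z0 _).
have segE g v i (t : R) (z : C) :
    z = (1 - t) *: node v i + t *: node v i.+1 <->
    c * z = (1 - t) *: node (turn g v) ((i + k g) %% p) +
            t *: node (turn g v) ((i + k g) %% p).+1.
  have sc a x : a *: (c * x) = c * (a *: x) := Rcomplex_scaleAr a c x.
  rewrite -scale_nodeS -scale_node !sc -mulrDr.
  by split=> [->//|]; exact: (mulfI c0).
have segE' g v i (t : R) (z : C) :
    z = (1 - t) *: node v i.+1 + t *: node v i <->
    c * z = (1 - t) *: node (turn g v) ((i + k g) %% p).+1 +
            t *: node (turn g v) ((i + k g) %% p).
  have := segE g v i (1 - t) z; rewrite subKr.
  by rewrite [t *: _ + _]addrC [t *: node (turn _ _) _ + _]addrC.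
case: x y => [[[g v] gv] x] [[[h v'] hv'] y]; split=> -[i [j [t []]]].
- case=> glu uv t01; have [ip jp] := proj2 Zreg _ _ _ _ glu.
  rewrite !side_cover // => /(segE g) xE /(segE' h) yE.
  exists ((i + k g) %% p)%N, ((j + k h) %% p)%N, t.
  rewrite !side_cover ?ltn_mod //; split=> //.
  split; first exact: pr_glued.
  apply/(translation_matchE Yreg); rewrite ?ltn_mod // !zeta_mod //.
  by apply/turn_match; exact: ((translation_matchE Zreg _ _ _ _ ip jp).1 uv).
- case=> glu uv t01; have [ip jp] := proj2 Yreg _ _ _ _ glu.
  rewrite !side_cover //=.
  have [m [h1 [n [gh hE iE jE]]]] := lift_glued glu.
  have [mp np] := proj2 Zreg _ _ _ _ gh.
  pose v1 := - (v * zeta ^+ m * zeta ^- n).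
  have gv1 : transport g0 h1 v1 := transport_across Zreg gv gh.
  have vv1 : v * zeta ^+ m = - (v1 * zeta ^+ n).
    by rewrite /v1 mulNr opprK mulfVK.
  have tE : turn h1 v1 = turn h v'.
    have := (translation_matchE Yreg _ _ _ _ ip jp).1 uv.
    rewrite iE jE !zeta_mod // ((turn_match g h1 _ _ _ _).2 vv1).
    by move=> /oppr_inj/(mulIf (z0 _)).
  have [hE' vE'] : h1 = h /\ v1 = v' := turn_inj gv1 hv' hE tE.
  move: gh iE jE vv1 hE tE; rewrite hE' vE' => gh -> -> vv1 _ _.
  move=> /(segE g v m t x).2 xE /(segE' h v' n t y).2 yE; exists m, n, t.
  rewrite !side_cover //; split=> //.
  by split=> //; exact/(translation_matchE Zreg).
Qed.

Lemma isometric_based_covers :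
  isometric (translation_cover g0) (translation_cover f0).
Proof.
exact: isometric_tile_bijection push_tile_bij scale_norm in_tile_push sewn_push.
Qed.

End Basepoints.

(** Coverings with the same holonomy kernel have the same translation cover.
    The hypotheses on q replace the statement about loops: q is an argument of
    the square of the directions, and it tells apart the tiles in a fibre. *)
Theorem isometric_covers (f : tile Y) (g : tile Z) :
  isometric (translation_cover f) (translation_cover g).
Proof.
apply: isometric_sym; have [w fw] := Y_conn f (pr g).
exact: isometric_based_covers fw.
Qed.

End Covering.
End RegularTilings.

(** * Quotient surfaces in integer coordinates *)

Lemma rot_wrap N i n : (i <= N)%N -> (n < N)%N -> (N - i <= n)%N ->
  (n - (N - i) < i)%N /\ ((n + i) %% N = n - (N - i))%N.
Proof.
move=> iN nN ge; split; first by lia.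
have -> : (n + i = n - (N - i) + N)%N by lia.
by rewrite modnDr modn_small //; lia.
Qed.

Section Cyclic.
Variable T : zmodType.
Implicit Types s t : seq T.

(** Reading lists cyclically turns rotations of vertex cycles into shifts of
    the index. *)
Definition cyc s (m : nat) : T := s`_(m %% size s).

Lemma cyc_mod s m : cyc s (m %% size s) = cyc s m.
Proof. by rewrite /cyc modn_mod. Qed.

Lemma cycS_mod s m : cyc s (m %% size s).+1 = cyc s m.+1.
Proof. by rewrite /cyc -addn1 modnDml addn1. Qed.

Lemma cycD_mod s m k : cyc s (m + k %% size s) = cyc s (m + k).
Proof. by rewrite /cyc modnDmr. Qed.

Lemma cyc_small s m : (m < size s)%N -> cyc s m = s`_m.
Proof. by move=> ms; rewrite /cyc modn_small. Qed.

Lemma cyc_rot s i m : (i <= size s)%N -> cyc (rot i s) m = cyc s (m + i).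
Proof.
move=> isz; case: (posnP (size s)) => [/size0nil ->|s0].
  by rewrite /cyc rot_oversize // !nth_nil.
rewrite /cyc size_rot -[in RHS]modnDml; set n := (m %% _)%N.
have ns : (n < size s)%N by rewrite ltn_mod.
move: ns isz; clearbody n; rewrite /rot nth_cat size_drop nth_drop => ns isz.
case: ltnP => [nlt|nge].
  by rewrite modn_small ?[(n + i)%N]addnC // -ltn_subRL.
have [nlt nE] := rot_wrap isz ns nge.
by rewrite nth_take // nE.
Qed.

Lemma eq_cyc s t : size s = size t -> (forall m, cyc s m = cyc t m) -> s = t.
Proof.
move=> st E; apply: (eq_from_nth (x0 := 0) st) => i si.
by rewrite -!cyc_small -?st.
Qed.

Lemma modn_turn (n i m : nat) : (0 < n)%N ->
  m + (n - i %% n) + i = m %[mod n].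
Proof.
move=> n0; rewrite -addnA -modnDmr -[((_ - _ + _) %% n)%N]modnDmr subnK.
  by rewrite modnn addn0.
by rewrite ltnW // ltn_mod.
Qed.

Lemma cyc_turn s i m : cyc s (m + (size s - i %% size s) + i) = cyc s m.
Proof.
case: (posnP (size s)) => [/size0nil ->|s0]; first by rewrite /cyc /= !nth_nil.
by rewrite /cyc modn_turn.
Qed.

End Cyclic.

Lemma cyc_map (T U : zmodType) (f : T -> U) (s : seq T) m : (0 < size s)%N ->
  cyc (map f s) m = f (cyc s m).
Proof. by move=> s0; rewrite /cyc size_map (nth_map 0) // ltn_mod. Qed.

Section Orbits.
Variables (R : realType) (L : set 'rV[R]_3).
Hypotheses (L0 : L 0) (LB : forall v w, L v -> L w -> L (v - w)).
Implicit Types (s t : seq 'rV[R]_3).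

Lemma subgroup_opp v : L v -> L (- v).
Proof. by move=> Lv; rewrite -sub0r; exact: LB. Qed.

Lemma subgroup_add v w : L v -> L w -> L (v + w).
Proof. by move=> Lv Lw; rewrite -[w]opprK; apply/LB/subgroup_opp. Qed.

Lemma cyc_shift v s m : (0 < size s)%N -> cyc (shift v s) m = cyc s m + v.
Proof. exact: cyc_map. Qed.

Lemma orbit_modP s t : (0 < size s)%N -> orbit_mod L s t <->
  size t = size s /\ exists v i, L v /\ forall m, cyc t m = cyc s (m + i) + v.
Proof.
move=> s0; split=> [[v Lv [i ->]]|[ts [v [i [Lv E]]]]].
  rewrite size_rot size_map; split=> //.
  case: (leqP i (size s)) => [is_|/ltnW si].
    by exists v, i; split=> // m; rewrite cyc_rot ?size_map // cyc_shift.
  exists v, 0%N; split=> // m.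
  by rewrite rot_oversize ?size_map // cyc_shift // addn0.
exists v => //; exists (i %% size s)%N.
apply: eq_cyc => [|m]; first by rewrite size_rot size_map.
by rewrite cyc_rot ?cyc_shift ?cycD_mod // size_map ltnW // ltn_mod.
Qed.

Lemma orbit_mod_eq s t : (0 < size s)%N -> orbit_mod L s t ->
  orbit_mod L t = orbit_mod L s.
Proof.
move=> s0 /(orbit_modP _ s0)[ts [v [i [Lv E]]]].
have t0 : (0 < size t)%N by rewrite ts.
apply/seteqP; split=> u.
  move=> /(orbit_modP _ t0)[ut [w [j [Lw F]]]].
  apply/orbit_modP => //; split; first by rewrite ut.
  exists (v + w), (j + i)%N; split; first exact: subgroup_add.
  by move=> m; rewrite F E addrA addnA.
move=> /(orbit_modP _ s0)[us [w [j [Lw F]]]].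
apply/orbit_modP => //; split; first by rewrite us.
exists (w - v), (j + (size s - i %% size s))%N; split; first exact: LB.
by move=> m; rewrite F E addnA cyc_turn addrACA addrN addr0.
Qed.

Lemma orbit_mod_refl s : (0 < size s)%N -> orbit_mod L s s.
Proof.
by move=> s0; apply/orbit_modP => //; split=> //; exists 0, 0%N; split=> // m;
  rewrite addn0 addr0.
Qed.

End Orbits.

(** Triples rather than integer row vectors, because equality and addition of
    triples compute. *)
Definition int3 : zmodType := (int * int * int)%type.

Section Vec.
Variables (R : realType) (N : nat).
Hypothesis N_gt0 : (0 < N)%N.

(** Out of range indices give 0, so that coord3 is additive for all indices. *)
Definition coord3 (x : int3) (i : nat) : int := nth 0 [:: x.1.1; x.1.2; x.2] i.

(** The denominator N accounts for the coordinates of Octa-8, which are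
    multiples of 1/3. *)
Definition vec (x : int3) : 'rV[R]_3 := \row_i ((coord3 x i)%:~R / N%:R).

Lemma vecE x i : vec x 0 i = (coord3 x i)%:~R / N%:R.
Proof. by rewrite mxE. Qed.

Lemma coord3B x y i : coord3 (x - y) i = coord3 x i - coord3 y i.
Proof. by case: i => [|[|[|i]]] //=; rewrite /coord3 /= !nth_nil subrr. Qed.

Lemma coord3D x y i : coord3 (x + y) i = coord3 x i + coord3 y i.
Proof. by case: i => [|[|[|i]]] //=; rewrite /coord3 /= !nth_nil addr0. Qed.

Lemma vecB x y : vec (x - y) = vec x - vec y.
Proof. by apply/rowP => i; rewrite !mxE coord3B intrB mulrBl. Qed.

Lemma vecD x y : vec (x + y) = vec x + vec y.
Proof. by apply/rowP => i; rewrite !mxE coord3D intrD mulrDl. Qed.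

Lemma vec_inj : injective vec.
Proof.
move=> [[a b] c] [[a' b'] c'] E.
have N0 : N%:R^-1 != 0 :> R by rewrite invr_neq0 // pnatr_eq0 -lt0n.
have F (i : 'I_3) : coord3 (a, b, c) i = coord3 (a', b', c') i.
  move: (congr1 (fun v : 'rV_3 => v 0 i) E); rewrite !vecE => /(mulIf N0).
  exact: intr_inj.
by have := (F 0, F 1, F (1 + 1)); rewrite /coord3 /= => -[[-> ->] ->].
Qed.

Definition sqnorm3 (x : int3) : int := x.1.1 ^+ 2 + x.1.2 ^+ 2 + x.2 ^+ 2.

Lemma euclid_vec x : euclid (vec x) = Num.sqrt (sqnorm3 x)%:~R / N%:R.
Proof.
rewrite /euclid /dot !big_ord_recl big_ord0 addr0 !mxE /= /coord3 /=.
have -> : Num.sqrt (sqnorm3 x)%:~R / N%:R =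
          Num.sqrt ((sqnorm3 x)%:~R / N%:R ^+ 2) :> R.
  rewrite sqrtrM ?ler0z ?addr_ge0 ?sqr_ge0 // sqrtrV ?sqr_ge0 //.
  by rewrite sqrtr_sqr ger0_norm ?ler0n.
congr Num.sqrt; rewrite /sqnorm3 !intrD !rmorphXn /=.
have N0 : N%:R != 0 :> R by rewrite pnatr_eq0 -lt0n.
by field.
Qed.

End Vec.

Definition lattice_test (D : pred int3) : Prop :=
  D 0 /\ forall x y, D x -> D y -> D (x - y).

(** M lists, in integer coordinates, exactly the faces that lie on the
    boundary; all the combinatorics of the quotient surface can be read off
    from M and the lattice test D. *)
Definition modelled (R : realType) (N p : nat) (D : pred int3)
    (M : seq (seq int3)) (L cell : set 'rV[R]_3) (faces : set (seq 'rV[R]_3)) :=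
  [/\ forall v, L v <-> exists2 d, D d & v = vec R N d,
      forall s, s \in M -> size s = p &
      forall s, (faces s /\ hull s `<=` boundary (translates L cell)) <->
        exists2 s', s' \in M & s = map (vec R N) s'].

Definition copy (D : pred int3) (s t : seq int3) : Prop :=
  exists i d, D d /\ forall m, cyc t m = cyc s (m + i) + d.

Section Model.
Variables (R : realType) (N p : nat) (D : pred int3) (M : seq (seq int3)).
Variables (L cell : set 'rV[R]_3) (faces : set (seq 'rV[R]_3)).
Hypotheses (N_gt0 : (0 < N)%N) (p_gt0 : (0 < p)%N).
Hypothesis D_lattice : lattice_test D.
Hypothesis model : modelled N p D M L cell faces.
Local Notation surface := (quotient_surface L cell faces).
Local Notation vec := (vec R N).
Implicit Types (A B : tile surface).

Let vec_cyc s m : size s = p -> vec (cyc s m) = cyc (map vec s) m.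
Proof. by move=> sp; rewrite cyc_map ?sp. Qed.

Let LE v : L v <-> exists2 d, D d & v = vec d.
Proof. by case: model. Qed.

Let sizeM s : s \in M -> size s = p.
Proof. by case: model => _ + _; apply. Qed.

Let vec0 : vec 0 = 0.
Proof. by have := vecB R N 0 0; rewrite !subrr. Qed.

Let L0 : L 0.
Proof. by apply/LE; exists 0; [case: D_lattice|rewrite vec0]. Qed.

Let LB v w : L v -> L w -> L (v - w).
Proof.
move=> /LE[d Dd ->] /LE[d' Dd' ->]; apply/LE; exists (d - d').
  by case: D_lattice => _; apply.
by rewrite vecB.
Qed.

Lemma lattice_testN d : D d -> D (- d).
Proof. by case: D_lattice => D0 DB Dd; rewrite -sub0r; exact: DB. Qed.

Lemma lattice_testD d d' : D d -> D d' -> D (d + d').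
Proof.
by case: D_lattice => _ DB Dd Dd'; rewrite -[d']opprK; apply/DB/lattice_testN.
Qed.

Lemma copy_sym s t : size s = size t -> copy D s t -> copy D t s.
Proof.
move=> st [i [d [Dd E]]]; exists (size s - i %% size s)%N, (- d).
by split=> [|m]; [exact: lattice_testN|rewrite E cyc_turn addrK].
Qed.

Lemma copy_trans s t u : copy D s t -> copy D t u -> copy D s u.
Proof.
move=> [i [d [Dd E]]] [j [d' [Dd' F]]]; exists (j + i)%N, (d + d').
by split=> [|m]; [exact: lattice_testD|rewrite F E addrA addnA].
Qed.

Lemma orbit_vec s v : size s = p -> orbit_mod L (map vec s) v <->
  exists t, [/\ v = map vec t, size t = p & copy D s t].
Proof.
move=> sp; have s0 : (0 < size (map vec s))%N by rewrite size_map sp.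
split=> [[w /LE[d Dd ->] [i ->]]|[t [-> tp [i [d [Dd E]]]]]].
  exists (rot i [seq x + d | x <- s]).
  have tp : size (rot i [seq x + d | x <- s]) = p by rewrite size_rot size_map.
  have vE : rot i (shift (vec d) (map vec s)) =
            map vec (rot i [seq x + d | x <- s]).
    rewrite map_rot /shift -!map_comp; congr (rot _ _); apply: eq_map => x /=.
    by rewrite vecD.
  split=> //.
  have : orbit_mod L (map vec s) (map vec (rot i [seq x + d | x <- s])).
    by exists (vec d); [apply/LE; exists d|exists i].
  move=> /(orbit_modP L _ s0)[_ [w' [j [/LE[d' Dd' ->] E]]]].
  exists j, d'; split=> // m; apply: (@vec_inj R N N_gt0).
  by rewrite vecD !vec_cyc // E.
apply/orbit_modP => //; rewrite !size_map tp sp; split=> //.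
exists (vec d), i; split; first by apply/LE; exists d.
by move=> m; rewrite -!vec_cyc // E vecD.
Qed.

(** The vertex cycle of a tile is an arbitrary choice in its orbit; whatever
    it is, it has integer coordinates and is a translated rotation of a face
    of M. *)
Lemma vertex_cycleP A : exists t, [/\ vertex_cycle A = map vec t, size t = p,
  exists2 s, s \in M & copy D s t & sval A = orbit_mod L (map vec t)].
Proof.
case: A => X [v [fv hv XE]]; rewrite /vertex_cycle /=.
have [_ _ /(_ v)[+ _]] := model; move=> /(_ (conj fv hv))[s sM vE].
have sp := sizeM sM.
have v0 : (0 < size v)%N by rewrite vE size_map sp.
have Xx : X (xget [::] X).
  by apply: (@xgetPex _ [::]); exists v; rewrite XE; exact: orbit_mod_refl.
have : orbit_mod L (map vec s) (xget [::] X) by rewrite -vE -XE.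
move=> /(orbit_vec _ sp)[t [tE tp st]]; exists t; split=> //; first by exists s.
have vx : orbit_mod L v (xget [::] X) by rewrite -XE.
by rewrite XE -tE (orbit_mod_eq L0 LB v0 vx).
Qed.

Definition cycle A : seq int3 := sval (cid (vertex_cycleP A)).

Lemma cycleE A : vertex_cycle A = map vec (cycle A).
Proof. by rewrite /cycle; case: (cid _) => t []. Qed.

Lemma size_cycle A : size (cycle A) = p.
Proof. by rewrite /cycle; case: (cid _) => t []. Qed.

Lemma cycle_copy A : exists2 s, s \in M & copy D s (cycle A).
Proof. by rewrite /cycle; case: (cid _) => t []. Qed.

(** A tile is the orbit of any of its vertex cycles. *)
Lemma tile_eq A B : copy D (cycle A) (cycle B) -> A = B.
Proof.
move=> AB; suff: sval A = sval B.
  by move: A B {AB} => [a Pa] [b Pb] /= ab; exact: eq_exist.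
have svE C : sval C = orbit_mod L (map vec (cycle C)).
  by rewrite /cycle; case: (cid _) => t [].
rewrite !svE; apply: esym; apply: (orbit_mod_eq L0 LB).
  by rewrite size_map size_cycle.
by apply/orbit_vec; rewrite ?size_cycle //; exists (cycle B); rewrite size_cycle.
Qed.

Lemma tile_of s : s \in M -> exists A, copy D s (cycle A).
Proof.
move=> sM; have [_ _ /(_ (map vec s))[_]] := model.
move=> /(_ (ex_intro2 _ _ s sM erefl))[fs hs].
have As : exists v, [/\ faces v, hull v `<=` boundary (translates L cell) &
    orbit_mod L (map vec s) = orbit_mod L v] by exists (map vec s).
pose A : tile surface := exist _ (orbit_mod L (map vec s)) As.
exists A; have [t [tE tp _ AE]] := vertex_cycleP A.
have : orbit_mod L (map vec s) (map vec (cycle A)).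
  rewrite -cycleE; apply: (@xgetPex _ [::] (orbit_mod L (map vec s))).
  by exists (map vec s); apply: orbit_mod_refl => //; rewrite size_map sizeM.
move=> /(orbit_vec _ (sizeM sM))[u [uE up su]].
have -> // : cycle A = u.
by apply: (@inj_map _ _ vec) => //; exact: vec_inj.
Qed.

Lemma size_vertex_cycle A : size (vertex_cycle A) = p.
Proof. by rewrite cycleE size_map size_cycle. Qed.

Lemma side_cycle A m : (m < p)%N ->
  side (vertex_cycle A) m = (vec (cyc (cycle A) m), vec (cyc (cycle A) m.+1)).
Proof.
move=> mp; rewrite cycleE !vec_cyc ?size_cycle // /side.
by rewrite -cyc_small ?size_map ?size_cycle // /cyc !size_map !size_cycle.
Qed.

Lemma gluedE A i B j : glued A i B j <-> [/\ (i < p)%N, (j < p)%N &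
  exists2 d, D d & cyc (cycle A) i = cyc (cycle B) j.+1 + d /\
                   cyc (cycle A) i.+1 = cyc (cycle B) j + d].
Proof.
have -> : glued A i B j = [/\ (i < size (vertex_cycle A))%N,
    (j < size (vertex_cycle B))%N & exists2 v, L v &
    (side (vertex_cycle A) i).1 = (side (vertex_cycle B) j).2 + v /\
    (side (vertex_cycle A) i).2 = (side (vertex_cycle B) j).1 + v] by [].
rewrite !size_vertex_cycle; split=> -[ip jp].
  rewrite !side_cycle // => -[_ /LE[d Dd ->] [/= E F]]; split=> //; exists d => //.
  by split; apply: (@vec_inj R N N_gt0); rewrite vecD.
case=> d Dd [E F]; rewrite !side_cycle //; split=> //; exists (vec d).
  by apply/LE; exists d.
by rewrite /= E F !vecD.
Qed.

Lemma glued_sym A i B j : glued A i B j -> glued B j A i.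
Proof.
move=> /gluedE[ip jp [d Dd [E F]]]; apply/gluedE; split=> //.
exists (- d); first exact: lattice_testN.
by rewrite E F !addrK.
Qed.

Lemma regular_model (l2 : int) :
  (forall s, s \in M -> forall i, sqnorm3 (cyc s i.+1 - cyc s i) = l2) ->
  regular_tiling p (Num.sqrt l2%:~R / N%:R) surface.
Proof.
move=> Ml; split=> [A|A i B j]; last by case/gluedE.
have -> : corners A = regular_polygon (size (vertex_cycle A))
    (euclid ((side (vertex_cycle A) 0).2 - (side (vertex_cycle A) 0).1)) by [].
rewrite size_vertex_cycle side_cycle //= -vecB euclid_vec //.
congr (regular_polygon _ (Num.sqrt _%:~R / _)).
have [s sM [i [d [Dd E]]]] := cycle_copy A.
by rewrite !E opprD addrACA subrr addr0 -(Ml s sM i); congr sqnorm3; rewrite add1n.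
Qed.

End Model.

(** * A finite test for coverings *)

Definition all_sides (p : nat) (M : seq (seq int3))
    (P : seq int3 -> nat -> bool) : bool :=
  all (fun s => all (P s) (iota 0 p)) M.

Definition has_side (p : nat) (M : seq (seq int3))
    (P : seq int3 -> nat -> bool) : bool :=
  has (fun s => has (P s) (iota 0 p)) M.

Lemma all_sidesP p M P : (0 < p)%N -> all_sides p M P ->
  forall s i, s \in M -> P s (i %% p)%N.
Proof.
by move=> p0 /allP + s i sM => /(_ s sM)/allP; apply; rewrite mem_iota ltn_mod.
Qed.

Lemma has_sideP p M P : has_side p M P -> exists s i, s \in M /\ P s i.
Proof. by move=> /hasP[s sM /hasP[i _ Psi]]; exists s, i. Qed.

Definition adjacent (p : nat) (s t : seq int3) : bool :=
  has (fun i => has (fun j => (cyc s i == cyc t j.+1) && (cyc s i.+1 == cyc t j))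
    (iota 0 p)) (iota 0 p).

Definition expand p (M S : seq (seq int3)) : seq (seq int3) :=
  [seq t <- M | (t \in S) || has (adjacent p ^~ t) S].

Section CoveringTest.
Variables (p : nat) (MY MZ : seq (seq int3)) (D : pred int3).
Variables (W : seq int3) (a : int3) (q : int3 * int3 * int3 -> nat).

(** A lattice invariant map to the vertices W of the base polyhedron: the w
    such that x + w is congruent to a, that is, the image of x under the
    central symmetry with centre a / 2. *)
Definition vertex_map (x : int3) : int3 :=
  nth 0 W (find (fun w => D (x + w - a)) W).

Definition edge (s : seq int3) (i : nat) : int3 * int3 * int3 :=
  (vertex_map (cyc s i), vertex_map (cyc s i.+1), cyc s i.+1 - cyc s i).

Definition base_simple : bool :=
  all uniq MY && all_sides p MY (fun s i => all_sides p MY (fun t j =>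
    (cyc s i == cyc t j) && (cyc s i.+1 == cyc t j.+1) ==>
    all (fun m => cyc s (m + i) == cyc t (m + j)) (iota 0 p))).

(** As many rounds of expansion as there are faces suffice. *)
Definition base_connected : bool :=
  all (fun s => all (mem (iter (size MY) (expand p MY) [:: s])) MY) MY.

Definition cover_closed : bool :=
  all_sides p MZ (fun s i => has_side p MZ (fun t j => [&& (j < p)%N,
    D (cyc s i - cyc t j.+1) & cyc s i - cyc t j.+1 == cyc s i.+1 - cyc t j])).

Definition cover_projects : bool :=
  all (fun s => has_side p MY (fun t i =>
    all (fun m => vertex_map (cyc s m) == cyc t (m + i)) (iota 0 p))) MZ.

(** The squared direction is multiplied by zeta ^+ 2 from one side to the
    next. *)
Definition argument_turns : bool :=
  all_sides p MZ (fun s i => q (edge s i.+1) == q (edge s i) + 2 %[mod p]).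

(** Both orientations of an edge have the same squared direction. *)
Definition argument_unoriented : bool :=
  all_sides p MZ (fun s i =>
    q ((edge s i).1.2, (edge s i).1.1, - (edge s i).2) == q (edge s i)).

(** The sides are tagged once with their invariants, so that the quadratic
    comparison only compares tags; the conditional avoids evaluating the rest
    for different tags. *)
Definition argument_separates : bool :=
  let sides := [seq ((edge s i).1, q (edge s i) %% p, (s, i))%N
                | s <- MZ, i <- iota 0 p] in
  all (fun x => all (fun y => if x.1 != y.1 then true else
    let: (s, i) := x.2 in let: (t, j) := y.2 in
    D (cyc s i - cyc t j) &&
    all (fun m => cyc s (m + i) == cyc t (m + j) + (cyc s i - cyc t j))
      (iota 0 p)) sides) sides.

Definition covering_test : bool :=
  [&& base_simple, base_connected, cover_closed, cover_projects,
      argument_turns, argument_unoriented & argument_separates].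

Section Isometric.
Variables (R : realType) (N : nat) (l2 : int).
Variables (cellY LZ cellZ : set 'rV[R]_3) (facesY facesZ : set (seq 'rV[R]_3)).
Hypotheses (N_gt0 : (0 < N)%N) (p_gt1 : (1 < p)%N) (l2_gt0 : 0 < l2).
Hypothesis D_lattice : lattice_test D.
Hypothesis modelY : modelled N p (pred1 0) MY [set 0] cellY facesY.
Hypothesis modelZ : modelled N p D MZ LZ cellZ facesZ.
Hypothesis lengths :
  all_sides p (MY ++ MZ) (fun s i => sqnorm3 (cyc s i.+1 - cyc s i) == l2).
Hypothesis test : covering_test.

Local Notation Y := (quotient_surface [set 0] cellY facesY).
Local Notation Z := (quotient_surface LZ cellZ facesZ).

Let p_gt0 : (0 < p)%N := ltn_trans (ltn0Sn 0) p_gt1.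

Let D0_lattice : lattice_test (pred1 (0 : int3)).
Proof. by split=> [|x y /eqP-> /eqP->] /=; rewrite ?subrr eqxx. Qed.

Let sizeY s : s \in MY -> size s = p. Proof. by case: modelY => _ + _; apply. Qed.
Let sizeZ s : s \in MZ -> size s = p. Proof. by case: modelZ => _ + _; apply. Qed.

Local Notation cycleY := (cycle N_gt0 p_gt0 D0_lattice modelY).
Local Notation cycleZ := (cycle N_gt0 p_gt0 D_lattice modelZ).

Lemma vertex_mapD x d : D d -> vertex_map (x + d) = vertex_map x.
Proof.
move=> Dd; rewrite /vertex_map; congr nth; apply: eq_find => w.
apply/idP/idP => Dx.
  have -> : x + w - a = (x + d + w - a) - d.
    by rewrite [x + d]addrC -!addrA [RHS]addrC !addrA subrK.
  by case: D_lattice => _; apply.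
have -> : x + d + w - a = (x + w - a) + d by rewrite [x + d + w]addrAC [LHS]addrAC.
exact: lattice_testD.
Qed.

Lemma edge_copy s t i d : D d -> (forall m, cyc t m = cyc s (m + i) + d) ->
  forall m, edge t m = edge s (m + i).
Proof.
move=> Dd E m; rewrite /edge !E !vertex_mapD // addSn.
by rewrite opprD addrACA subrr addr0.
Qed.

Lemma edge_mod s m : size s = p -> edge s (m %% p) = edge s m.
Proof. by move=> <-; rewrite /edge cyc_mod cycS_mod. Qed.

Lemma cyc_modp (s : seq int3) m : size s = p -> cyc s (m %% p) = cyc s m.
Proof. by move=> <-; rewrite cyc_mod. Qed.

Lemma cycS_modp (s : seq int3) m : size s = p -> cyc s (m %% p).+1 = cyc s m.+1.
Proof. by move=> <-; rewrite cycS_mod. Qed.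

Lemma cyc_turnp (s : seq int3) i m : size s = p ->
  cyc s (m + (p - i %% p) + i) = cyc s m.
Proof. by move=> <-; rewrite cyc_turn. Qed.

Lemma copy_shifted (D' : pred int3) s t i j d : size s = p -> D' d ->
  (forall m, cyc s (m + i) = cyc t (m + j) + d) -> copy D' t s.
Proof.
move=> sp Dd E; exists (p - i %% p + j)%N, d; split=> // m.
by rewrite addnA -E -sp cyc_turn.
Qed.

Lemma mod_all (P : nat -> bool) :
  (forall m, P (m %% p)%N = P m) -> all P (iota 0 p) -> forall m, P m.
Proof.
by move=> Pmod /allP Pall m; rewrite -Pmod; apply: Pall; rewrite mem_iota ltn_mod.
Qed.

Let regY : regular_tiling p (Num.sqrt l2%:~R / N%:R) Y.
Proof.
apply: (regular_model N_gt0 p_gt0 D0_lattice modelY) => s sM i.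
have sM' : s \in MY ++ MZ by rewrite mem_cat sM.
have /= /eqP <- := all_sidesP p_gt0 lengths i sM'.
by rewrite -(sizeY sM) cyc_mod cycS_mod.
Qed.

Let regZ : regular_tiling p (Num.sqrt l2%:~R / N%:R) Z.
Proof.
apply: (regular_model N_gt0 p_gt0 D_lattice modelZ) => s sM i.
have sM' : s \in MY ++ MZ by rewrite mem_cat sM orbT.
have /= /eqP <- := all_sidesP p_gt0 lengths i sM'.
by rewrite -(sizeZ sM) cyc_mod cycS_mod.
Qed.

Lemma base_adjacent s t (f g : tile Y) : s \in MY -> t \in MY -> adjacent p s t ->
  copy (pred1 0) s (cycleY f) -> copy (pred1 0) t (cycleY g) ->
  exists u, transport f g u.
Proof.
move=> sM tM /hasP[i _ /hasP[j _ /andP[/eqP st0 /eqP st1]]].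
move=> [a' [_ [/eqP-> E]]] [b [_ [/eqP-> F]]].
have sE m : cyc s m = cyc (cycleY f) (m + (p - a' %% p)).
  by rewrite E addr0 -(sizeY sM) cyc_turn.
have tE m : cyc t m = cyc (cycleY g) (m + (p - b %% p)).
  by rewrite F addr0 -(sizeY tM) cyc_turn.
have fg : glued f ((i + (p - a' %% p)) %% p)%N g ((j + (p - b %% p)) %% p)%N.
  apply/(gluedE N_gt0 p_gt0 D0_lattice modelY); rewrite !ltn_mod p_gt0.
  split=> //; exists 0; first exact: eqxx.
  rewrite !addr0.
  have szf := size_cycle N_gt0 p_gt0 D0_lattice modelY f.
  have szg := size_cycle N_gt0 p_gt0 D0_lattice modelY g.
  rewrite !(cyc_modp _ szf, cycS_modp _ szf, cyc_modp _ szg, cycS_modp _ szg).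
  rewrite -!addSn -!sE -!tE.
  by split.
exists (- (1 * zeta R p ^+ ((i + (p - a' %% p)) %% p) *
  zeta R p ^- ((j + (p - b %% p)) %% p))).
apply: (transport_across p_gt1 _ regY (transport_base f) fg).
by rewrite divr_gt0 ?ltr0n // sqrtr_gt0 ltr0z.
Qed.

Lemma base_conn (f g : tile Y) : exists u, transport f g u.
Proof.
have [/andP[_ conn] _] := andP test.
have [s sM sf] := cycle_copy N_gt0 p_gt0 D0_lattice modelY f.
have [t tM tg] := cycle_copy N_gt0 p_gt0 D0_lattice modelY g.
have {conn} := allP (allP (proj1 (andP (proj2 (andP test)))) s sM) t tM.
move: (size MY) => n /= tn; elim: n t tM tn g tg => [|n IH] t tM /=.
  rewrite inE => /eqP-> g sg; exists 1.
  have <- : f = g; last exact: transport_base.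
  apply: (@tile_eq _ _ _ _ _ _ _ _ N_gt0 p_gt0 D0_lattice modelY).
  apply: copy_trans (D0_lattice) _ _ _ _ sg.
  by apply: (copy_sym D0_lattice) sf; rewrite size_cycle sizeY.
rewrite mem_filter => /andP[/orP[tn|/hasP[t' t'n adj]] _] g tg.
  exact: IH tM tn g tg.
have t'M : t' \in MY.
  case: n {IH} t'n => [|n] /=; first by rewrite inE => /eqP->.
  by rewrite mem_filter => /andP[].
have [h t'h] := tile_of N_gt0 p_gt0 D0_lattice modelY t'M.
have [u fu] := IH t' t'M t'n h t'h.
have [v hv] := base_adjacent t'M tM adj t'h tg.
by exists (u * v); exact: transport_trans hv.
Qed.

Let szY (f : tile Y) : size (cycleY f) = p.
Proof. exact: size_cycle. Qed.
Let szZ (f : tile Z) : size (cycleZ f) = p.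
Proof. exact: size_cycle. Qed.

Lemma base_unique (f : tile Y) i g j g' j' :
  glued f i g j -> glued f i g' j' -> g = g' /\ j = j'.
Proof.
move=> /(gluedE N_gt0 p_gt0 D0_lattice modelY)[_ jp [_ /eqP-> [E0 E1]]].
move=> /(gluedE N_gt0 p_gt0 D0_lattice modelY)[_ j'p [_ /eqP-> [F0 F1]]].
have /andP[/andP[/allP simple uniq_side] _] := test.
have [s sM sg] := cycle_copy N_gt0 p_gt0 D0_lattice modelY g.
have [t tM tg'] := cycle_copy N_gt0 p_gt0 D0_lattice modelY g'.
have [b [_ [/eqP-> G]]] := sg; have [b' [_ [/eqP-> G']]] := tg'.
have sE := cyc_modp _ (sizeY sM); have tE := cyc_modp _ (sizeY tM).
have sSE := cycS_modp _ (sizeY sM); have tSE := cycS_modp _ (sizeY tM).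
have := all_sidesP p_gt0 (all_sidesP p_gt0 uniq_side (j + b) sM) (j' + b') tM.
rewrite /= !sE !tE !sSE !tSE -!addSn.
have -> : cyc s (j + b) = cyc t (j' + b').
  by rewrite -[LHS]addr0 -G -[RHS]addr0 -G' -[LHS]addr0 -E1 F1 addr0.
have -> : cyc s (j.+1 + b) = cyc t (j'.+1 + b').
  by rewrite -[LHS]addr0 -G -[RHS]addr0 -G' -[LHS]addr0 -E0 F0 addr0.
rewrite !eqxx /= => /mod_all st.
have {}st m : cyc s (m + (j + b) %% p) = cyc t (m + (j' + b') %% p) + 0.
  apply/eqP; rewrite addr0; apply: st => n.
  by rewrite -sE modnDml sE -tE modnDml tE.
have gg' : g = g'.
  apply: (@tile_eq _ _ _ _ _ _ _ _ N_gt0 p_gt0 D0_lattice modelY).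
  have gs : copy (pred1 0) (cycleY g) s by apply: copy_sym sg; rewrite ?szY ?sizeY.
  apply: copy_trans gs (copy_trans _ _ tg') => //.
  apply: (copy_sym D0_lattice); first by rewrite !sizeY.
  by apply: (copy_shifted (sizeY sM) _ st); exact: eqxx.
split=> //; move: F1 E1; rewrite -gg' !addr0 => -> /eqP.
rewrite !G !addr0 /cyc !(sizeY sM).
rewrite nth_uniq ?sizeY ?ltn_mod ?simple // eqn_modDr.
by rewrite !modn_small // => /eqP.
Qed.

(** The neighbour is found on the listed faces and moved to the tile at hand
    by a lattice vector. *)
Lemma cover_mate (f : tile Z) i : (i < p)%N -> exists g j, glued f i g j.
Proof.
move=> ip; have /and4P[_ _ closed _] := test.
have [s sM sf] := cycle_copy N_gt0 p_gt0 D_lattice modelZ f.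
have [b [d [Dd E]]] := sf.
have /has_sideP[t [j [tM /and3P[jp De /eqP se]]]] :=
  all_sidesP p_gt0 closed (i + b) sM.
move: De se; rewrite (cyc_modp _ (sizeZ sM)) (cycS_modp _ (sizeZ sM)).
set e := (X in D X) => De se.
have [g tg] := tile_of N_gt0 p_gt0 D_lattice modelZ tM.
have [c [d' [Dd' F]]] := tg.
exists g, ((j + (p - c %% p)) %% p)%N.
apply/(gluedE N_gt0 p_gt0 D_lattice modelZ); rewrite ltn_mod; split=> //.
exists (e + d - d').
  by case: D_lattice => _; apply => //; exact: lattice_testD.
rewrite (cyc_modp _ (szZ g)) (cycS_modp _ (szZ g)) !F -addSn.
rewrite !(cyc_turnp _ _ (sizeZ tM)) !E addSn.
have drop x : x + d' + (e + d - d') = x + e + d.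
  by rewrite addrACA subrr addr0 addrA.
rewrite !drop; split; congr (_ + _); last by rewrite /e se addrC subrK.
by rewrite /e addrC subrK.
Qed.

(** The image of a tile under vertex_map is a face of the base up to a
    rotation k of the numbering; k records the independent choices of vertex
    cycles upstairs and downstairs. *)
Lemma projection_ex (f : tile Z) : exists gk : tile Y * nat,
  forall m, vertex_map (cyc (cycleZ f) m) = cyc (cycleY gk.1) (m + gk.2).
Proof.
have /and5P[_ _ _ /allP proj _] := test.
have [s sM [b [d [Dd E]]]] := cycle_copy N_gt0 p_gt0 D_lattice modelZ f.
have /has_sideP[t [i [tM st]]] := proj s sM.
have {}st m : vertex_map (cyc s m) = cyc t (m + i).
  apply/eqP; apply: mod_all st m => n; rewrite (cyc_modp _ (sizeZ sM)).
  by rewrite -(cyc_modp (_ + _) (sizeY tM)) modnDml (cyc_modp _ (sizeY tM)).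
have [g [c [_ [/eqP-> F]]]] := tile_of N_gt0 p_gt0 D0_lattice modelY tM.
exists (g, b + i + (p - c %% p))%N => m /=.
rewrite E vertex_mapD // st !addnA F addr0.
by rewrite (cyc_turnp _ _ (sizeY tM)).
Qed.

Lemma separatesP s t i j : argument_separates -> s \in MZ -> t \in MZ ->
  (edge s i).1 = (edge t j).1 -> q (edge s i) = q (edge t j) %[mod p] ->
  D (cyc s (i %% p) - cyc t (j %% p)) &&
  all (fun m => cyc s (m + i %% p) ==
    cyc t (m + j %% p) + (cyc s (i %% p) - cyc t (j %% p))) (iota 0 p).
Proof.
move=> sep sM tM st qst.
have side_in u m : u \in MZ ->
    ((edge u m).1, q (edge u m) %% p, (u, m %% p))%N \in
    [seq ((edge s i).1, q (edge s i) %% p, (s, i))%N | s <- MZ, i <- iota 0 p].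
  move=> uM; rewrite -(edge_mod m (sizeZ uM)).
  by apply/allpairsP; exists (u, m %% p)%N; rewrite mem_iota ltn_mod.
have := allP (allP sep _ (side_in s i sM)) _ (side_in t j tM).
case: ifP => [/negP[]|_ //].
by apply/eqP; exact: (congr2 pair st qst).
Qed.

(** Every tile is a copy of a listed face, up to a rotation of its vertex
    cycle and a lattice translation, and edges keep their images and their
    invariant q under these; so the test on the lists gives the hypotheses of
    isometric_covers. *)
Theorem isometric_models (f : tile Y) (g : tile Z) :
  isometric (translation_cover f) (translation_cover g).
Proof.
have l_gt0 : 0 < Num.sqrt l2%:~R / N%:R :> R.
  by rewrite divr_gt0 ?ltr0n // sqrtr_gt0 ltr0z.
have /choice [pk pkE] := projection_ex.
have pkS h i : vertex_map (cyc (cycleZ h) i.+1) =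
    cyc (cycleY (pk h).1) (i + (pk h).2).+1.
  by rewrite pkE addSn.
have /and5P[_ _ _ _ /and3P[turns unoriented separates]] := test.
have edgeZ (h : tile Z) : exists s, [/\ s \in MZ, copy D s (cycleZ h) & exists b d,
    [/\ D d, forall m, cyc (cycleZ h) m = cyc s (m + b) + d &
        forall m, edge (cycleZ h) m = edge s (m + b)]].
  have [s sM sh] := cycle_copy N_gt0 p_gt0 D_lattice modelZ h.
  have [b [d [Dd E]]] := sh; exists s; split=> //; exists b, d; split=> //.
  exact: edge_copy Dd E.
apply: (@isometric_covers _ _ _ p_gt1 l_gt0 _ _ regY regZ
  (fun h => (pk h).1) (fun h => (pk h).2) _ _ _ _ _
  (fun h i => q (edge (cycleZ h) i))).
- exact: (glued_sym N_gt0 p_gt0 D0_lattice modelY).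
- exact: base_conn.
- exact: base_unique.
- exact: cover_mate.
- move=> h i h' j /(gluedE N_gt0 p_gt0 D_lattice modelZ)[ip jp [d Dd [E F]]].
  apply/(gluedE N_gt0 p_gt0 D0_lattice modelY); rewrite !ltn_mod p_gt0.
  split=> //; exists 0; first exact: eqxx.
  rewrite !addr0 !(cyc_modp _ (szY _)) !(cycS_modp _ (szY _)).
  by rewrite -!pkE -!pkS E F !vertex_mapD.
- move=> h i h' j /(gluedE N_gt0 p_gt0 D_lattice modelZ)[ip jp [d Dd [E F]]].
  have [s [sM _ [b [d' [_ _ sE]]]]] := edgeZ h'.
  have /eqP := all_sidesP p_gt0 unoriented (j + b) sM.
  rewrite (edge_mod _ (sizeZ sM)) -sE => <-.
  rewrite {1}/edge E F !vertex_mapD //= opprD addrACA subrr addr0.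
  by rewrite opprB.
- move=> h i ip; have [s [sM _ [b [d' [_ _ sE]]]]] := edgeZ h.
  rewrite (edge_mod _ (szZ h)); apply/eqP.
  have := all_sidesP p_gt0 turns (i + b) sM.
  rewrite (edge_mod _ (sizeZ sM)) -(edge_mod (_ %% _).+1 (sizeZ sM)).
  by rewrite -addn1 modnDml addn1 (edge_mod _ (sizeZ sM)) -addSn -!sE.
- move=> h h' i j ip jp hh' ij qq.
  have [s [sM sh [b [d [Dd E sE]]]]] := edgeZ h.
  have [t [tM th' [b' [d' [Dd' F tE]]]]] := edgeZ h'.
  have := separatesP separates sM tM (i := i + b) (j := j + b').
  rewrite -sE -tE => /(_ _ qq).
  have -> : (edge (cycleZ h) i).1 = (edge (cycleZ h') j).1.
    rewrite /edge /= !pkE !addSn hh'.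
    have szh' := szY (pk h').1.
    rewrite -(cyc_modp (i + _) szh') -(cycS_modp (i + _) szh') ij.
    by rewrite (cyc_modp _ szh') (cycS_modp _ szh').
  move=> /(_ erefl)/andP[De st].
  have {}st m : cyc s (m + (i + b) %% p) = cyc t (m + (j + b') %% p) +
      (cyc s ((i + b) %% p) - cyc t ((j + b') %% p)).
    apply/eqP; apply: mod_all st m => n.
    rewrite -(cyc_modp (_ %% _ + _) (sizeZ sM)) modnDml (cyc_modp _ (sizeZ sM)).
    by rewrite -(cyc_modp (_ %% _ + _) (sizeZ tM)) modnDml (cyc_modp _ (sizeZ tM)).
  apply: (@tile_eq _ _ _ _ _ _ _ _ N_gt0 p_gt0 D_lattice modelZ).
  have hs : copy D (cycleZ h) s by apply: copy_sym sh; rewrite ?szZ ?sizeZ.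
  apply: copy_trans hs (copy_trans _ _ th') => //.
  apply: (copy_sym D_lattice); first by rewrite !sizeZ.
  exact: (copy_shifted (sizeZ sM) De st).
Qed.

End Isometric.
End CoveringTest.

(** * The two coverings *)

Definition sgn (b : bool) : int := if b then -1 else 1.
Definition int3_of (a b c : int) : int3 := (a, b, c).
Definition dot3 (x y : int3) : int := x.1.1 * y.1.1 + x.1.2 * y.1.2 + x.2 * y.2.
Definition det3 (x y z : int3) : int :=
  x.1.1 * (y.1.2 * z.2 - y.2 * z.1.2) - x.1.2 * (y.1.1 * z.2 - y.2 * z.1.1)
  + x.2 * (y.1.1 * z.1.2 - y.1.2 * z.1.1).

(** Coordinates are scaled by 3 for the octahedron and Octa-8. *)
Definition octa_face3 (F : bool * bool * bool) : seq int3 :=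
  let: (a, b, c) := F in
  let s := [:: int3_of (3 * sgn a) 0 0; int3_of 0 (3 * sgn b) 0;
               int3_of 0 0 (3 * sgn c)] in
  if a (+) b (+) c then rev s else s.

Definition octants : seq (bool * bool * bool) :=
  [seq (ab, c) | ab <- [seq (a, b) | a <- [:: false; true], b <- [:: false; true]],
                 c <- [:: false; true]].

Definition opposite (F : bool * bool * bool) : bool * bool * bool :=
  (~~ F.1.1, ~~ F.1.2, ~~ F.2).

(** Only vertices v of the octahedron are reflected: v has scalar product 3 or
    -3 with the normal n, so it is fixed or moved by 4 n. *)
Definition reflect3 (F : bool * bool * bool) (x : int3) : int3 :=
  let n := int3_of (sgn F.1.1) (sgn F.1.2) (sgn F.2) in
  if dot3 x n == 3 then x else x + n *+ 4.

Definition octa_faces3 : seq (seq int3) := map octa_face3 octants.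

Definition octa8_faces3 : seq (seq int3) :=
  flatten [seq [seq rev (map (reflect3 F) (octa_face3 G)) | G <- octants
                & (G != F) && (G != opposite F)] | F <- octants].

(** The scaled lattice consists of the vectors 4 v such that the three
    coordinates of v have the same parity. *)
Definition octa8_test (x : int3) : bool :=
  [&& (4 %| x.1.1)%Z, (8 %| x.1.1 - x.1.2)%Z & (8 %| x.1.2 - x.2)%Z].

Definition octa_vertices : seq int3 :=
  [:: int3_of 3 0 0; int3_of (- 3) 0 0; int3_of 0 3 0; int3_of 0 (- 3) 0;
      int3_of 0 0 3; int3_of 0 0 (- 3)].

(** The determinant is 0, 36 or -36 on the edges of Octa-8, according to the
    displacement along the axis orthogonal to both end points, and
    distinguishes the three edges over an edge of the octahedron. *)
Definition octa8_argument (e : int3 * int3 * int3) : nat :=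
  absz (modz (divz (det3 e.1.1 e.1.2 e.2) 36) 3).

Lemma octa8_covering_test :
  covering_test 3 octa_faces3 octa8_faces3 octa8_test octa_vertices 0
    octa8_argument.
Proof. by vm_compute. Qed.

Definition unit3 (j : nat) : int3 := int3_of (j == 0)%N (j == 1)%N (j == 2)%N.

Definition square3 (ib : nat * bool) : seq int3 :=
  let: (i, b) := ib in
  let o := unit3 i *+ b in let u := unit3 (i.+1 %% 3) in
  let v := unit3 (i.+2 %% 3) in
  let s := [:: o; o + u; o + u + v; o + v] in
  if b then s else rev s.

Definition cube_sides : seq (nat * bool) :=
  [seq (i, b) | i <- iota 0 3, b <- [:: false; true]].

Definition cube_faces3 : seq (seq int3) := map square3 cube_sides.

Definition mucube_faces3 : seq (seq int3) :=
  [seq [seq x + unit3 t.1 | x <- square3 t.2] |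
    t <- [seq (j, ib) | j <- iota 0 3, ib <- cube_sides] & t.1 != t.2.1].

Definition mucube_test (x : int3) : bool :=
  [&& (2 %| x.1.1)%Z, (2 %| x.1.2)%Z & (2 %| x.2)%Z].

Definition cube_vertices : seq int3 :=
  [:: int3_of 0 0 0; int3_of 0 0 1; int3_of 0 1 0; int3_of 0 1 1;
      int3_of 1 0 0; int3_of 1 0 1; int3_of 1 1 0; int3_of 1 1 1].

(** The scalar product is 1 or -1, according to the parity of the unit
    interval that the edge spans on its axis, and distinguishes the two edges
    over an edge of the cube. *)
Definition mucube_argument (e : int3 * int3 * int3) : nat :=
  absz (modz (dot3 (e.1.2 - e.1.1) e.2) 4).

Lemma mucube_covering_test :
  covering_test 4 cube_faces3 mucube_faces3 mucube_test cube_vertices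
    (int3_of 1 1 1) mucube_argument.
Proof. by vm_compute. Qed.

(** * Convex geometry in space *)

Section Geometry.
Variable R : realType.
Local Notation V := 'rV[R]_3.
Implicit Types (x y p m : V) (s : seq V) (U : set V).

Lemma sum3 (T : nmodType) (F : 'I_3 -> T) : \sum_i F i = F 0 + F 1 + F 2.
Proof.
rewrite !big_ord_recl big_ord0 addr0 addrA.
by congr (_ + F _ + F _); apply: val_inj.
Qed.

Lemma row3P x y : x 0 0 = y 0 0 -> x 0 1 = y 0 1 -> x 0 2 = y 0 2 -> x = y.
Proof.
move=> E0 E1 E2; apply/rowP => -[[|[|[|//]]] i3].
- by move: E0; congr (x _ _ = y _ _); apply: val_inj.
- by move: E1; congr (x _ _ = y _ _); apply: val_inj.
- by move: E2; congr (x _ _ = y _ _); apply: val_inj.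
Qed.

Lemma dotE x y : dot x y = x 0 0 * y 0 0 + x 0 1 * y 0 1 + x 0 2 * y 0 2.
Proof. exact: sum3. Qed.

Lemma hull_le (f : V -> R) (b : R) s x : scalar f -> hull s x ->
  (forall v, v \in s -> f v <= b) -> f x <= b.
Proof.
move=> flin [w [w0 w1 ->]] fb.
have f0 : f 0 = 0 by have := flin (-1) 0 0; rewrite scaler0 addr0 mulN1r addNr.
have -> : f (\sum_i w i *: s`_i) = \sum_i w i * f s`_i.
  by elim/big_rec2: _ => [//|i y z _ <-]; rewrite flin.
rewrite -[leRHS]mul1r -w1 mulr_suml; apply: ler_sum => i _.
by apply: ler_wpM2l => //; apply/fb/mem_nth.
Qed.

(** The weights of a convex combination have sum 1, so the constant part f 0
    passes through it. *)
Lemma hull_affine (f : V -> V) s x : linear (fun y => f y - f 0) ->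
  hull s x -> hull (map f s) (f x).
Proof.
move=> flin /(hull_linear flin)[w [w0 w1 E]].
have sz : size (map f s) = size (map (fun y => f y - f 0) s).
  by rewrite !size_map.
have bij : bijective (cast_ord sz).
  by exists (cast_ord (esym sz)) => i; rewrite (cast_ordK, cast_ordKV).
exists (fun i => w (cast_ord sz i)); split=> [//||].
  by rewrite -w1; apply: esym; apply: reindex; exact: onW_bij.
transitivity (f x - f 0 + \sum_i w i *: f 0).
  by rewrite -scaler_suml w1 scale1r subrK.
rewrite E -big_split.
rewrite (reindex (cast_ord sz)) /=; last exact: onW_bij.
apply: eq_bigr => i _; rewrite -scalerDr.
have is_ : (i < size s)%N by rewrite -(size_map f s); exact: ltn_ord.
by rewrite !(nth_map 0) // subrK.
Qed.

Lemma centroid_hull s : s != [::] -> hull s ((size s)%:R^-1 *: \sum_(v <- s) v).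
Proof.
move=> s0; have n0 : (size s)%:R != 0 :> R by rewrite pnatr_eq0 size_eq0.
exists (fun=> (size s)%:R^-1); split=> [i||].
- by rewrite invr_ge0.
- by rewrite sumr_const card_ord -[_ *+ _]mulr_natr mulVf.
- by rewrite (big_nth 0) big_mkord scaler_sumr.
Qed.

(** Points of the segment from p to m come arbitrarily close to p. *)
Lemma not_interior U p m :
  (forall t : R, 0 < t < 1 -> ~ U (p + t *: (m - p))) -> ~ interior U p.
Proof.
move=> out /nbhs_ballP[e /= e0 pU].
have d0 : 0 < `|m - p| + 1 + e by rewrite ltr_pwDr // addr_ge0.
pose t := e / (`|m - p| + 1 + e) / 2.
have t0 : 0 < t by rewrite !divr_gt0.
have t1 : t < 1.
  rewrite /t ltr_pdivrMr // mul1r ltr_pdivrMr //.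
  have := normr_ge0 (m - p); lra.
apply: (out t); rewrite ?t0 //; apply: pU; rewrite -ball_normE /=.
rewrite opprD addrA subrr add0r normrN normrZ gtr0_norm //.
have tE : t * (`|m - p| + 1 + e) = e / 2.
  by rewrite /t mulrAC divfK // gt_eqF.
by have := mulr_gt0 t0 e0; move: tE; lra.
Qed.

Lemma interior_box U p e : 0 < e ->
  (forall x, (forall i, `|x 0 i - p 0 i| < e) -> U x) -> interior U p.
Proof.
move=> e0 box; apply/nbhs_ballP; exists e => //= x px.
by apply: box => i; case: px => _ /(_ 0 i); rewrite -ball_normE /= distrC.
Qed.

End Geometry.

(** * The octahedron and its reflections *)

Section Octahedron.
Variable R : realType.
Local Notation V := 'rV[R]_3.
Implicit Types (x y p m : V) (s : seq V) (U : set V) (a b c : bool).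
Local Notation sg b := ((-1) ^+ (nat_of_bool b) : R).

Lemma basisE (i j : 'I_3) : basis R i 0 j = (j == i)%:R.
Proof. by rewrite mxE eqxx. Qed.

Lemma sign_vectorE a b c :
  [/\ sign_vector R a b c 0 0 = sg a, sign_vector R a b c 0 1 = sg b &
      sign_vector R a b c 0 2 = sg c].
Proof.
by rewrite /sign_vector !mxE /= !mulr0 !mulr1 !addr0 !add0r.
Qed.

Lemma dot_sign x a b c :
  dot x (sign_vector R a b c) = x 0 0 * sg a + x 0 1 * sg b + x 0 2 * sg c.
Proof. by rewrite dotE; have [-> -> ->] := sign_vectorE a b c. Qed.

Lemma dot_sign_sign a b c : dot (sign_vector R a b c) (sign_vector R a b c) = 3.
Proof.
rewrite dot_sign; have [-> -> ->] := sign_vectorE a b c.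
by rewrite -!expr2 !sqrr_sign; ring.
Qed.

Lemma reflectionE a b c x (t := 2 * (dot x (sign_vector R a b c) - 1) / 3) :
  [/\ face_reflection a b c x 0 0 = x 0 0 - t * sg a,
      face_reflection a b c x 0 1 = x 0 1 - t * sg b &
      face_reflection a b c x 0 2 = x 0 2 - t * sg c].
Proof.
have [E0 E1 E2] := sign_vectorE a b c.
have coordE (k : R) (n : V) i : (x - k *: n) 0 i = x 0 i - k * n 0 i.
  by rewrite !mxE.
by rewrite /face_reflection dot_sign_sign !coordE E0 E1 E2.
Qed.

Lemma reflectionK a b c : involutive (@face_reflection R a b c).
Proof.
move=> x; have [E0 E1 E2] := reflectionE a b c x.
have [F0 F1 F2] := reflectionE a b c (face_reflection a b c x).
apply: row3P; rewrite ?F0 ?F1 ?F2 !dot_sign ?E0 ?E1 ?E2 !dot_sign.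
- by case: a b c {E0 E1 E2 F0 F1 F2} => [] [] []; field.
- by case: a b c {E0 E1 E2 F0 F1 F2} => [] [] []; field.
- by case: a b c {E0 E1 E2 F0 F1 F2} => [] [] []; field.
Qed.

Lemma linear_coords (f : V -> V) :
  (forall k x y (i : 'I_3), f (k *: x + y) 0 i - f 0 0 i =
     k * (f x 0 i - f 0 0 i) + (f y 0 i - f 0 0 i)) ->
  linear (fun y => f y - f 0).
Proof. by move=> E k x y; apply/rowP => i; rewrite !mxE E. Qed.

Lemma reflection_affine a b c :
  linear (fun y => face_reflection a b c y - face_reflection a b c 0).
Proof.
apply: linear_coords => k x y.
have [E0 E1 E2] := reflectionE a b c x; have [F0 F1 F2] := reflectionE a b c y.
have [G0 G1 G2] := reflectionE a b c 0.
have [H0 H1 H2] := reflectionE a b c (k *: x + y).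
have H : dot (k *: x + y) (sign_vector R a b c) =
    k * dot x (sign_vector R a b c) + dot y (sign_vector R a b c).
  by rewrite !dot_sign !mxE; ring.
have G : dot 0 (sign_vector R a b c) = 0 by rewrite dot_sign !mxE; ring.
have lin i : (k *: x + y) 0 i = k * x 0 i + y 0 i by rewrite !mxE.
have zero (i : 'I_3) : (0 : V) 0 i = 0 by rewrite mxE.
move=> [[|[|[|//]]] i3].
- rewrite (_ : Ordinal i3 = 0); last exact: val_inj.
  by rewrite E0 F0 G0 H0 H G lin zero; field.
- rewrite (_ : Ordinal i3 = 1); last exact: val_inj.
  by rewrite E1 F1 G1 H1 H G lin zero; field.
- rewrite (_ : Ordinal i3 = 2); last exact: val_inj.
  by rewrite E2 F2 G2 H2 H G lin zero; field.
Qed.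

(** For the converse, the slack left by the absolute values of the coordinates
    is shared equally between the six vertices, which does not change their
    barycentre. *)
Lemma solid_octahedronP x : solid_octahedron x <->
  forall a b c, x 0 0 * sg a + x 0 1 * sg b + x 0 2 * sg c <= 1.
Proof.
split=> [xO a b c|le1].
  rewrite -dot_sign.
  apply: (@hull_le _ (fun y => dot y (sign_vector R a b c)) _ _ _ _ xO).
    by move=> k y z; rewrite !dot_sign !mxE; ring.
  move=> v; rewrite !inE dot_sign.
  move=> /or4P[/eqP->|/eqP->|/eqP->|/or3P[/eqP->|/eqP->|/eqP->]];
    rewrite !mxE /=; case: a b c => [] [] []; lra.
pose pos (u : R) := Num.max u 0.
have posE u : 0 <= pos u /\ pos u - pos (- u) = u /\
    (pos u + pos (- u) = u \/ pos u + pos (- u) = - u).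
  rewrite /pos; case: (leP u 0) => u0; case: (leP (- u) 0) => u0'; split; lra.
pose t := (1 - (pos (x 0 0) + pos (- x 0 0)) - (pos (x 0 1) + pos (- x 0 1)) -
  (pos (x 0 2) + pos (- x 0 2))) / 6.
have t0 : 0 <= t.
  rewrite /t.
  have [_ [_ P0]] := posE (x 0 0); have [_ [_ P1]] := posE (x 0 1);
  have [_ [_ P2]] := posE (x 0 2).
  have := le1 false false false; have := le1 false false true.
  have := le1 false true false; have := le1 false true true.
  have := le1 true false false; have := le1 true false true.
  have := le1 true true false; have := le1 true true true.
  rewrite !expr0 !expr1; case: P0 => ->; case: P1 => ->; case: P2 => ->; lra.
(* The weights of e_0, - e_0, e_1, - e_1, e_2, - e_2. *)
pose w := [:: pos (x 0 0) + t; pos (- x 0 0) + t; pos (x 0 1) + t;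
  pos (- x 0 1) + t; pos (x 0 2) + t; pos (- x 0 2) + t].
exists (fun i => w`_i); split.
- move=> [i /= i6]; have posge u : 0 <= pos u + t.
    by rewrite addr_ge0 //; case: (posE u).
  by case: i i6 => [|[|[|[|[|[|]]]]]] //= _.
- rewrite !big_ord_recl big_ord0 /= /bump /= /t; lra.
- have [_ [P0 _]] := posE (x 0 0); have [_ [P1 _]] := posE (x 0 1).
  have [_ [P2 _]] := posE (x 0 2).
  rewrite !big_ord_recl big_ord0 /= /bump /=.
  by apply: row3P; rewrite !mxE /=; lra.
Qed.

End Octahedron.

Section Faces.
Variable R : realType.
Local Notation V := 'rV[R]_3.
Implicit Types (x y p m : V) (s : seq V) (U : set V) (a b c : bool).
Local Notation sg b := ((-1) ^+ (nat_of_bool b) : R).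

Lemma sgnE b : (sgn b)%:~R = sg b.
Proof. by case: b. Qed.

Lemma vec_of (N : nat) (i j k : int) (x := vec R N (int3_of i j k)) :
  [/\ x 0 0 = i%:~R / N%:R, x 0 1 = j%:~R / N%:R & x 0 2 = k%:~R / N%:R].
Proof. by rewrite /x !vecE. Qed.

Lemma octahedron_faceE a b c :
  octahedron_face R a b c = map (vec R 3) (octa_face3 (a, b, c)).
Proof.
rewrite /octahedron_face /octa_face3.
have E0 : (-1) ^+ a *: basis R 0 = vec R 3 (int3_of (3 * sgn a) 0 0).
  have [F0 F1 F2] := vec_of 3 (3 * sgn a) 0 0.
  by apply: row3P; rewrite ?F0 ?F1 ?F2 ?intrM ?sgnE !mxE /=; field.
have E1 : (-1) ^+ b *: basis R 1 = vec R 3 (int3_of 0 (3 * sgn b) 0).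
  have [F0 F1 F2] := vec_of 3 0 (3 * sgn b) 0.
  by apply: row3P; rewrite ?F0 ?F1 ?F2 ?intrM ?sgnE !mxE /=; field.
have E2 : (-1) ^+ c *: basis R 2 = vec R 3 (int3_of 0 0 (3 * sgn c)).
  have [F0 F1 F2] := vec_of 3 0 0 (3 * sgn c).
  by apply: row3P; rewrite ?F0 ?F1 ?F2 ?intrM ?sgnE !mxE /=; field.
by rewrite E0 E1 E2; case: ifP; rewrite ?map_rev.
Qed.

Lemma reflection_vec a b c d e f :
  map (@face_reflection R a b c) (octahedron_face R d e f) =
  map (vec R 3) (map (reflect3 (a, b, c)) (octa_face3 (d, e, f))).
Proof.
rewrite octahedron_faceE -!map_comp; apply/eq_in_map => v vF.
change (face_reflection a b c (vec R 3 v) = vec R 3 (reflect3 (a, b, c) v)).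
have [E0 E1 E2] := reflectionE a b c (vec R 3 v).
have [N0 N1 N2] : [/\ sign_vector R a b c 0 0 = sg a, sign_vector R a b c 0 1 = sg b &
      sign_vector R a b c 0 2 = sg c] := sign_vectorE R a b c.
have dotv : dot (vec R 3 v) (sign_vector R a b c) =
    (dot3 v (int3_of (sgn a) (sgn b) (sgn c)))%:~R / 3.
  by rewrite dotE N0 N1 N2 !vecE /coord3 /= /dot3 /= !intrD !intrM !sgnE; field.
have dot_v : dot3 v (int3_of (sgn a) (sgn b) (sgn c)) = 3 \/
             dot3 v (int3_of (sgn a) (sgn b) (sgn c)) = - 3%:Z.
  have : v \in [:: int3_of (3 * sgn d) 0 0; int3_of 0 (3 * sgn e) 0;
               int3_of 0 0 (3 * sgn f)].
    by move: vF; rewrite /octa_face3; case: ifP => _; rewrite ?mem_rev.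
  rewrite !inE => /or3P[] /eqP->; rewrite /dot3 /=; case: (a); case: (b); case: (c);
    by case: (d); case: (e); case: (f); rewrite /=; (left; done) || (right; done).
have -> : reflect3 (a, b, c) v =
  if dot3 v (int3_of (sgn a) (sgn b) (sgn c)) == 3 then v
  else v + int3_of (sgn a *+ 4) (sgn b *+ 4) (sgn c *+ 4) by [].
case: dot_v => dv; rewrite dv.
  by apply: row3P; rewrite ?E0 ?E1 ?E2 dotv dv; field.
have [F0 F1 F2] := vec_of 3 (sgn a *+ 4) (sgn b *+ 4) (sgn c *+ 4).
have -> : (- 3%:Z == 3) = false by [].
rewrite vecD; have addE (u w : V) i : (u + w) 0 i = u 0 i + w 0 i by rewrite mxE.
by apply: row3P; rewrite ?E0 ?E1 ?E2 dotv dv addE ?F0 ?F1 ?F2 ?rmorphMn /=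
  ?sgnE ?intrN; field.
Qed.

End Faces.

Section Boundary.
Variable R : realType.
Local Notation V := 'rV[R]_3.
Implicit Types (x y p m : V) (s : seq V) (U : set V) (a b c : bool).
Local Notation sg b := ((-1) ^+ (nat_of_bool b) : R).

(** The point m is an outside witness for all the points of the face at once. *)
Lemma face_boundary U s m : hull s `<=` U ->
  (forall p (t : R), hull s p -> 0 < t < 1 -> ~ U (p + t *: (m - p))) ->
  hull s `<=` boundary U.
Proof.
move=> sU out p sp; split; first exact/subset_closure/sU.
by apply: (not_interior (m := m)) => t t01; exact: out.
Qed.

Lemma translates0 (A : set V) : translates [set 0] A = A.
Proof.
apply/seteqP; split=> x; first by case=> _ ->; rewrite subr0.
by move=> Ax; exists 0 => //; rewrite subr0.
Qed.

Lemma lin3_scalar (k0 k1 k2 : R) :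
  scalar (fun y : V => k0 * y 0 0 + k1 * y 0 1 + k2 * y 0 2).
Proof. by move=> k y z; rewrite !mxE; ring. Qed.

Lemma solid_octant x a b c : 0 <= sg a * x 0 0 -> 0 <= sg b * x 0 1 ->
  0 <= sg c * x 0 2 -> sg a * x 0 0 + sg b * x 0 1 + sg c * x 0 2 <= 1 ->
  solid_octahedron x.
Proof.
move=> x0 x1 x2 sum1; apply/solid_octahedronP => a' b' c'.
have flip (e e' : bool) (u : R) : 0 <= sg e * u -> u * sg e' <= sg e * u.
  by case: e; case: e'; rewrite /= ?expr0 ?expr1 ; lra.
have := flip a a' _ x0; have := flip b b' _ x1; have := flip c c' _ x2; lra.
Qed.

Lemma hull_octahedron_face a b c x : hull (octahedron_face R a b c) x ->
  [/\ 0 <= sg a * x 0 0, 0 <= sg b * x 0 1, 0 <= sg c * x 0 2 &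
      sg a * x 0 0 + sg b * x 0 1 + sg c * x 0 2 = 1].
Proof.
move=> hx.
have bound k0 k1 k2 (d : R) : k0 * sg a <= d -> k1 * sg b <= d -> k2 * sg c <= d ->
    k0 * x 0 0 + k1 * x 0 1 + k2 * x 0 2 <= d.
  move=> d0 d1 d2; apply: (hull_le (lin3_scalar k0 k1 k2) hx) => v vF.
  have : v \in [:: sg a *: basis R 0; sg b *: basis R 1; sg c *: basis R 2].
    by move: vF; rewrite /octahedron_face; case: ifP => _; rewrite ?mem_rev.
  by rewrite !inE => /or3P[] /eqP->; rewrite !mxE /=; lra.
have sg2 e : sg e * sg e = 1 by rewrite -expr2 sqrr_sign.
have sgN e : - sg e * sg e = -1 by rewrite mulNr sg2.
split.
- by have := bound (- sg a) 0 0 0; rewrite sgN !mul0r; lra.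
- by have := bound 0 (- sg b) 0 0; rewrite sgN !mul0r; lra.
- by have := bound 0 0 (- sg c) 0; rewrite sgN !mul0r; lra.
apply/eqP; rewrite eq_le; apply/andP; split.
  by apply: bound; rewrite sg2.
by have := bound (- sg a) (- sg b) (- sg c) (-1); rewrite !sgN; lra.
Qed.

(** The linear form of the face is 1 on it and 3 at its normal vector, which
    serves as outside witness. *)
Lemma octahedron_boundary a b c :
  hull (octahedron_face R a b c) `<=`
    boundary (translates [set 0] (@solid_octahedron R)).
Proof.
rewrite translates0; apply: (face_boundary (m := sign_vector R a b c)).
  move=> x /hull_octahedron_face[x0 x1 x2 sum1].
  by apply: solid_octant x0 x1 x2 _; rewrite sum1.
move=> p t /hull_octahedron_face[_ _ _ sum1] t01 /solid_octahedronP /(_ a b c).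
have [E0 E1 E2] := sign_vectorE R a b c.
have lin (u v : V) i : (u + t *: (v - u)) 0 i = u 0 i + t * (v 0 i - u 0 i).
  by rewrite !mxE.
have sg2 e : sg e * sg e = 1 by rewrite -expr2 sqrr_sign.
rewrite !lin E0 E1 E2; set lhs := (X in X <= 1).
have -> : lhs = 1 + t * 2.
  transitivity ((1 - t) * (sg a * p 0 0 + sg b * p 0 1 + sg c * p 0 2) +
    t * (sg a * sg a + sg b * sg b + sg c * sg c)); first by rewrite /lhs; ring.
  by rewrite sum1 !sg2; ring.
by move: t01; lra.
Qed.

Lemma octahedron_modelled : modelled 3 3 (pred1 0) octa_faces3 [set 0]
  (@solid_octahedron R) (@octahedron_faces R).
Proof.
split.
- move=> v; have v0 : vec R 3 0 = 0 by have := vecB R 3 0 0; rewrite !subrr.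
  by split=> [->|[d /eqP-> ->]]; [exists 0; rewrite //= eqxx|rewrite v0].
- have sizes : all (fun t => size t == 3) octa_faces3 by vm_compute.
  by move=> s /(allP sizes)/eqP.
- move=> s; split=> [[[a [b [c ->]]] _]|[_ /mapP[[[a b] c] _ ->] ->]].
    exists (octa_face3 (a, b, c)); last exact: octahedron_faceE.
    by apply: map_f; case: a; case: b; case: c.
  rewrite -octahedron_faceE; split; first by exists a, b, c.
  exact: octahedron_boundary.
Qed.

End Boundary.

(** * Octa-8 *)

Section LatticeFacts.
Variables (R : realType) (G : set 'rV[R]_3).

Lemma lattice_add v w : lattice G v -> lattice G w -> lattice G (v + w).
Proof.
move=> Lv; elim=> [|w' g _ IH Gg|w' g _ IH Gg]; first by rewrite addr0.
- by rewrite addrA; exact: latticeD.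
- by rewrite addrA; exact: latticeB.
Qed.

Lemma lattice_opp v : lattice G v -> lattice G (- v).
Proof.
elim=> [|w' g _ IH Gg|w' g _ IH Gg]; first by rewrite oppr0; exact: lattice0.
- by rewrite opprD; exact: latticeB.
- by rewrite opprB addrC; exact: latticeD.
Qed.

Lemma lattice_mulz v (k : int) : lattice G v -> lattice G (v *~ k).
Proof.
move=> Lv; have Ln n : lattice G (v *+ n).
  by elim: n => [|n IH]; [exact: lattice0|rewrite mulrS; exact: lattice_add].
by case: k => n; [exact: Ln|rewrite NegzE mulrNz; apply/lattice_opp/Ln].
Qed.

Lemma lattice_gen g : G g -> lattice G g.
Proof. by move=> Gg; rewrite -[g]add0r; apply: latticeD => //; exact: lattice0. Qed.

End LatticeFacts.

Section Octa8Lattice.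
Variable R : realType.
Local Notation V := 'rV[R]_3.
Local Notation sg b := ((-1) ^+ (nat_of_bool b) : R).

Lemma octa8_testP (x : int3) : octa8_test x <-> exists k i j : int,
  x = int3_of (k * 4 + i * 8) (k * 4 + j * 8) (k * 4).
Proof.
case: x => [[x1 x2] x3]; rewrite /octa8_test /=; split.
  move=> /and3P[/dvdzP[k kE] /dvdzP[i iE] /dvdzP[j jE]].
  by exists (k - 2 * i - 2 * j), (i + j), j; congr (_, _, _); lia.
case=> k [i [j [-> -> ->]]]; apply/and3P; split; apply/dvdzP.
- by exists (k + i * 2); lia.
- by exists (i - j); lia.
- by exists j; lia.
Qed.

Lemma octa8_test_lattice : lattice_test octa8_test.
Proof.
split=> // x y /octa8_testP[k [i [j ->]]] /octa8_testP[k' [i' [j' ->]]].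
apply/octa8_testP; exists (k - k'), (i - i'), (j - j').
by congr (_, _, _) => /=; lia.
Qed.

Lemma octa8_generator a b c : (4 / 3) *: sign_vector R a b c =
  vec R 3 (int3_of (4 * sgn a) (4 * sgn b) (4 * sgn c)).
Proof.
have [E0 E1 E2] := sign_vectorE R a b c.
have [F0 F1 F2] := vec_of R 3 (4 * sgn a) (4 * sgn b) (4 * sgn c).
have scaleE (u : V) i : ((4 / 3) *: u) 0 i = 4 / 3 * u 0 i by rewrite mxE.
apply: row3P; rewrite scaleE ?E0 ?E1 ?E2 ?F0 ?F1 ?F2 intrM sgnE.
- by field.
- by field.
- by field.
Qed.

Lemma octa8_latticeE v : @octa8_lattice R v <->
  exists2 d, octa8_test d & v = vec R 3 d.
Proof.
have gen a b c : octa8_test (int3_of (4 * sgn a) (4 * sgn b) (4 * sgn c)).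
  by case: a; case: b; case: c.
split.
  have [_ testB] := octa8_test_lattice.
  elim=> {v} [|v g _ [d Dd ->] [a [b [c ->]]]|v g _ [d Dd ->] [a [b [c ->]]]].
  - by exists 0 => //; have := vecB R 3 0 0; rewrite !subrr.
  - exists (d + int3_of (4 * sgn a) (4 * sgn b) (4 * sgn c)).
      exact: (lattice_testD octa8_test_lattice).
    by rewrite vecD octa8_generator.
  - exists (d - int3_of (4 * sgn a) (4 * sgn b) (4 * sgn c)); first exact: testB.
    by rewrite vecB octa8_generator.
case=> d /octa8_testP[k [i [j ->]]] ->.
pose g a b c := (4 / 3) *: sign_vector R a b c.
have Lg a b c : @octa8_lattice R (g a b c).
  by apply: lattice_gen; exists a, b, c.
have -> : vec R 3 (int3_of (k * 4 + i * 8) (k * 4 + j * 8) (k * 4)) =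
    g false false false *~ k + (g false false false + g false true true) *~ i +
    (g false false false + g true false true) *~ j.
  have [F0 F1 F2] := vec_of R 3 (k * 4 + i * 8) (k * 4 + j * 8) (k * 4).
  have addE (u w : V) l : (u + w) 0 l = u 0 l + w 0 l by rewrite mxE.
  have mulE (u : V) (n : int) l : (u *~ n) 0 l = u 0 l * n%:~R.
    by rewrite -scaler_int mxE mulrC.
  have gE a b c : [/\ g a b c 0 0 = 4 / 3 * sg a, g a b c 0 1 = 4 / 3 * sg b &
      g a b c 0 2 = 4 / 3 * sg c].
    by have [E0 E1 E2] := sign_vectorE R a b c; split; rewrite mxE ?E0 ?E1 ?E2.
  have [A0 A1 A2] := gE false false false; have [B0 B1 B2] := gE false true true.
  have [C0 C1 C2] := gE true false true.
  apply: row3P; rewrite !addE !mulE !addE;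
    rewrite ?F0 ?F1 ?F2 ?A0 ?A1 ?A2 ?B0 ?B1 ?B2 ?C0 ?C1 ?C2.
  - by rewrite !intrD !intrM !expr0 !expr1; field.
  - by rewrite !intrD !intrM !expr0 !expr1; field.
  - by rewrite !intrM !expr0 !expr1; field.
apply: lattice_add; last exact: lattice_mulz (lattice_add (Lg _ _ _) (Lg _ _ _)).
apply: lattice_add (lattice_mulz _ (Lg _ _ _)) _.
exact: lattice_mulz (lattice_add (Lg _ _ _) (Lg _ _ _)).
Qed.

End Octa8Lattice.

Section Octa8.
Variable R : realType.
Local Notation V := 'rV[R]_3.
Implicit Types (x y p m : V) (s : seq V) (U : set V) (a b c d e f : bool).
Local Notation sg b := ((-1) ^+ (nat_of_bool b) : R).

Definition octa8_solid : set V := translates (@octa8_lattice R) (@octa8_cell R).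

Lemma octa8_cellE x : octa8_cell x <-> solid_octahedron x \/
  exists a b c, solid_octahedron (face_reflection a b c x).
Proof.
split=> [[|[a [b [c [y yO <-]]]]]|[|[a [b [c xO]]]]]; [by left| |by left|].
  by right; exists a, b, c; rewrite reflectionK.
by right; exists a, b, c, (face_reflection a b c x); rewrite ?reflectionK.
Qed.

(** The reflected octahedron fits in the cube of side 4/3 of its octant. These
    cubes tile space, which is why the reflected octahedra of Octa-8 do not
    overlap. *)
Lemma reflected_in_box x a b c : solid_octahedron (face_reflection a b c x) ->
  [/\ 0 <= sg a * x 0 0 <= 4 / 3, 0 <= sg b * x 0 1 <= 4 / 3 &
      0 <= sg c * x 0 2 <= 4 / 3].
Proof.
rewrite -[in X in _ -> X](reflectionK a b c x).
move: (face_reflection a b c x) => z /solid_octahedronP zO.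
have [E0 E1 E2] := reflectionE a b c z; rewrite E0 E1 E2 dot_sign.
have := zO false false false; have := zO false false true.
have := zO false true false; have := zO false true true.
have := zO true false false; have := zO true false true.
have := zO true true false; have := zO true true true.
move: (z 0 0) (z 0 1) (z 0 2) => z0 z1 z2.
by case: (a); case: (b); case: (c); rewrite /= ?expr0 ?expr1 => *;
  split; apply/andP; split; lra.
Qed.

Lemma intr_between (k n : int) :
  n%:~R - 1 < k%:~R :> R -> k%:~R < n%:~R + 1 :> R -> k = n.
Proof.
have -> : n%:~R - 1 = (n - 1)%:~R :> R by rewrite intrB.
have -> : n%:~R + 1 = (n + 1)%:~R :> R by rewrite intrD.
by rewrite !ltr_int; lia.
Qed.

(** If a point of the open cube in the direction e lies in a translate of the
    cube in the direction e', the translation is 0 or one step, according to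
    whether the directions agree. *)
Lemma lattice_coordinate (e e' : bool) (u v : R) (k : int) : v = 4 / 3 * k%:~R ->
  0 < sg e * u < 4 / 3 -> 0 <= sg e' * (u - v) <= 4 / 3 ->
  sgn e * k = (e != e').
Proof.
move=> -> /andP[u0 u1] /andP[w0 w1]; apply: intr_between; rewrite intrM sgnE.
  by move: u0 u1 w0 w1; case: e; case: e' => /=; rewrite ?expr0 ?expr1; lra.
by move: u0 u1 w0 w1; case: e; case: e' => /=; rewrite ?expr0 ?expr1; lra.
Qed.

Lemma octa8_vec_coord (k i j : int)
    (v := vec R 3 (int3_of (k * 4 + i * 8) (k * 4 + j * 8) (k * 4))) :
  [/\ v 0 0 = 4 / 3 * (k + 2 * i)%:~R, v 0 1 = 4 / 3 * (k + 2 * j)%:~R &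
      v 0 2 = 4 / 3 * k%:~R].
Proof.
rewrite /v; have [-> -> ->] := vec_of R 3 (k * 4 + i * 8) (k * 4 + j * 8) (k * 4).
by rewrite !intrD !intrM; split; field.
Qed.

Lemma octa8_lattice_coord v : octa8_lattice v <-> exists k i j : int,
  [/\ v 0 0 = 4 / 3 * (k + 2 * i)%:~R, v 0 1 = 4 / 3 * (k + 2 * j)%:~R &
      v 0 2 = 4 / 3 * k%:~R :> R].
Proof.
split=> [/octa8_latticeE[d /octa8_testP[k [i [j ->]]] ->]|[k [i [j [v0 v1 v2]]]]].
  by exists k, i, j; exact: octa8_vec_coord.
apply/octa8_latticeE.
exists (int3_of (k * 4 + i * 8) (k * 4 + j * 8) (k * 4)).
  by apply/octa8_testP; exists k, i, j.
have [w0 w1 w2] := octa8_vec_coord k i j.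
by apply: row3P; rewrite ?v0 ?v1 ?v2 ?w0 ?w1 ?w2.
Qed.

Lemma solid_coord x : solid_octahedron x ->
  [/\ -1 <= x 0 0 <= 1, -1 <= x 0 1 <= 1 & -1 <= x 0 2 <= 1].
Proof.
move=> /solid_octahedronP xO.
have := xO false false false; have := xO false false true.
have := xO false true false; have := xO false true true.
have := xO true false false; have := xO true false true.
have := xO true true false; have := xO true true true.
rewrite /= ?expr0 ?expr1; move: (x 0 0) (x 0 1) (x 0 2) => z0 z1 z2 *.
by split; apply/andP; split; lra.
Qed.

(** A translate of the central octahedron that meets an open cube of side 4/3
    is centred at a corner of this cube; here coordinate by coordinate. *)
Lemma lattice_step e (u v : R) (k : int) : v = 4 / 3 * k%:~R ->
  0 < sg e * u < 4 / 3 -> -1 <= u - v <= 1 -> exists d : bool, sgn e * k = d.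
Proof.
move=> -> /andP[u0 u1] /andP[w0 w1].
have lo : (-1)%:~R < (sgn e * k)%:~R :> R.
  by rewrite intrM sgnE; case: (e) u0 u1; rewrite /= ?expr0 ?expr1; lra.
have hi : (sgn e * k)%:~R < 2%:~R :> R.
  by rewrite intrM sgnE; case: (e) u0 u1; rewrite /= ?expr0 ?expr1; lra.
exists (sgn e * k == 1); case: eqVneq => [->//|ne1].
by move: lo hi ne1; rewrite !ltr_int; lia.
Qed.

(** The three coordinates of a lattice vector have the same parity, so of the
    corners of a cube of side 4/3 only two opposite ones are lattice points. *)
Lemma same_parity a b c (i j k : int) (d0 d1 d2 : bool) :
  sgn a * (k + 2 * i) = d0 -> sgn b * (k + 2 * j) = d1 -> sgn c * k = d2 ->
  d0 = d1 /\ d0 = d2.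
Proof.
have turn (e : bool) (n : int) : exists h : int, sgn e * n = n + 2 * h.
  by case: e; [exists (- n); rewrite /sgn; lia|exists 0; rewrite /sgn; lia].
have [h0 ->] := turn a (k + 2 * i); have [h1 ->] := turn b (k + 2 * j).
have [h2 ->] := turn c k; clear.
by case: d0; case: d1; case: d2 => /= *; split=> //; exfalso; lia.
Qed.

(** In an open cube of side 4/3, between the planes of the two opposite
    triangles, the solid reduces to one reflected octahedron: the central
    octahedra at the two lattice corners stay beyond these planes, and every
    other reflected octahedron has its own cube. *)
Lemma octa8_inside x a b c : 0 < sg a * x 0 0 < 4 / 3 ->
  0 < sg b * x 0 1 < 4 / 3 -> 0 < sg c * x 0 2 < 4 / 3 ->
  1 < sg a * x 0 0 + sg b * x 0 1 + sg c * x 0 2 < 3 ->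
  octa8_solid x -> solid_octahedron (face_reflection a b c x).
Proof.
move=> x0 x1 x2 /andP[sum1 sum3] [v /octa8_lattice_coord[k [i [j [v0 v1 v2]]]]].
have xv l : (x - v) 0 l = x 0 l - v 0 l by rewrite !mxE.
have sg2 e : sg e * sg e = 1 by rewrite -expr2 sqrr_sign.
have kE e (d : bool) (n : int) : sgn e * n = d -> n%:~R = d%:R * sg e :> R.
  by case: e; case: d => /= nE; [rewrite (_ : n = -1)|rewrite (_ : n = 0)
    |rewrite (_ : n = 1)|rewrite (_ : n = 0)]; rewrite ?mul0r ?mul1r //; lia.
case/octa8_cellE=> [xO|[a' [b' [c' xO]]]].
  have [w0 w1 w2] := solid_coord xO; rewrite !xv in w0 w1 w2.
  (* The octahedron is centred at the corner 0 of the cube or at the opposite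
     one. *)
  have [d k0] := lattice_step v0 x0 w0; have [d' k1] := lattice_step v1 x1 w1.
  have [d'' k2] := lattice_step v2 x2 w2.
  have [dd' dd''] := same_parity k0 k1 k2; rewrite -dd' in k1; rewrite -dd'' in k2.
  have {}k0 := kE _ _ _ k0; have {}k1 := kE _ _ _ k1; have {}k2 := kE _ _ _ k2.
  have sgN e : sg (~~ e) = - sg e by rewrite signrN.
  move/solid_octahedronP: xO => /(_ (a (+) d) (b (+) d) (c (+) d)).
  rewrite !xv v0 v1 v2 k0 k1 k2; move: sum1 sum3; clear -sg2 sgN.
  case: d; rewrite ?addbT ?addbF ?sgN ?mul0r ?mulr0 ?subr0.
    move=> _ sum3; rewrite !mul1r => sum1.
    have : sg a * sg a + sg b * sg b + sg c * sg c = 3 by rewrite !sg2; ring.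
    by lra.
  by move=> sum1 _; lra.
have [w0 w1 w2] := reflected_in_box xO; rewrite !xv in w0 w1 w2.
have k0 := lattice_coordinate v0 x0 w0; have k1 := lattice_coordinate v1 x1 w1.
have k2 := lattice_coordinate v2 x2 w2.
suff -> : face_reflection a b c x = face_reflection a' b' c' (x - v) by [].
have [d01 d02] := same_parity k0 k1 k2.
(* By parity the signs of the two octants differ everywhere or nowhere. *)
have xor (e e' : bool) : e' = e (+) (e != e') by case: e; case: e'.
have aE := xor a a'; have bE := xor b b'; have cE := xor c c'.
rewrite -d01 in bE k1; rewrite -d02 in cE k2.
move: (a != a') k0 k1 k2 aE bE cE => d k0 k1 k2 -> -> -> {xO w0 w1 w2 d01 d02 x0 x1 x2}.
have {}k0 := kE _ _ _ k0; have {}k1 := kE _ _ _ k1; have {}k2 := kE _ _ _ k2.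
have [E0 E1 E2] := reflectionE a b c x.
have [F0 F1 F2] := reflectionE (a (+) d) (b (+) d) (c (+) d) (x - v).
rewrite dot_sign in E0 E1 E2; rewrite dot_sign !xv v0 v1 v2 k0 k1 k2 in F0 F1 F2.
case: d {k0 k1 k2} F0 F1 F2; last first.
  rewrite !addbF !mul0r !mulr0 !subr0 => F0 F1 F2.
  by apply: row3P; rewrite ?E0 ?E1 ?E2 ?F0 ?F1 ?F2.
rewrite !addbT !signrN !mul1r => F0 F1 F2; move: E0 E1 E2 F0 F1 F2.
have -> : (x 0 0 - 4 / 3 * sg a) * - sg a + (x 0 1 - 4 / 3 * sg b) * - sg b +
    (x 0 2 - 4 / 3 * sg c) * - sg c =
    4 - (x 0 0 * sg a + x 0 1 * sg b + x 0 2 * sg c).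
  transitivity (4 / 3 * (sg a * sg a + sg b * sg b + sg c * sg c) -
    (x 0 0 * sg a + x 0 1 * sg b + x 0 2 * sg c)); first by ring.
  by rewrite !sg2; field.
move: (x 0 0 * sg a + _ + _) => r E0 E1 E2 F0 F1 F2.
by apply: row3P; rewrite ?E0 ?E1 ?E2 ?F0 ?F1 ?F2; field.
Qed.

Lemma affine_segment (g : V -> V) x y t : linear (fun z => g z - g 0) ->
  g (x + t *: (y - x)) = g x + t *: (g y - g x).
Proof.
move=> glin; have A := glin (-1) x y; have B := glin t (y - x) x.
rewrite scaleN1r [- x + y]addrC in A; rewrite A [_ + x]addrC in B.
apply/rowP => i; move: (congr1 (fun v : V => v 0 i) B).
by rewrite !mxE => /eqP; rewrite subr_eq => /eqP->; ring.
Qed.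

(** Numerical core of octa8_out, in coordinates where G is the positive
    octant. The signs g are those of F relative to G. The point z is at
    parameter t on a segment from the face G to the multiple 11/30 of the
    normal vector of G; the factor exceeds 1/3, so the point is outside the
    octahedron, and is less than 2/5, so its reflection stays in the cube and
    between the two planes. The other two coordinates follow by cyclic
    permutation. *)
Lemma reflected_bump (g0 g1 g2 : bool) (z0 z1 z2 u0 u1 u2 t : R)
    (r := sg g0 * z0 + sg g1 * z1 + sg g2 * z2) :
  ~~ ((g0 == g1) && (g1 == g2)) ->
  0 <= u0 -> 0 <= u1 -> 0 <= u2 -> u0 + u1 + u2 = 1 - t -> 0 < t < 1 ->
  z0 = u0 + 11 / 30 * t -> z1 = u1 + 11 / 30 * t -> z2 = u2 + 11 / 30 * t ->
  0 < sg g0 * z0 - 2 * (r - 1) / 3 < 4 / 3 /\ -1 < r < 1.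
Proof.
move=> neq u0_ge0 u1_ge0 u2_ge0 sum /andP[t0 t1] z0E z1E z2E.
have tE : t = 1 - u0 - u1 - u2 by lra.
rewrite {}/r {}z0E {}z1E {}z2E tE.
have {}t0 : u0 + u1 + u2 < 1 by lra.
have {}t1 : 0 < u0 + u1 + u2 by lra.
move: u0_ge0 u1_ge0 u2_ge0 t0 t1; clear -neq.
by case: g0 g1 g2 neq => [] [] [] //= _; rewrite ?expr0 ?expr1 => *;
  split; apply/andP; split; lra.
Qed.

(** The triple u holds the barycentric coordinates of the starting point in G,
    scaled by 1 - t. *)
Lemma octa8_out a b c d e f (u0 u1 u2 t : R) x :
  (d, e, f) != (a, b, c) -> (d, e, f) != (~~ a, ~~ b, ~~ c) ->
  0 <= u0 -> 0 <= u1 -> 0 <= u2 -> u0 + u1 + u2 = 1 - t -> 0 < t < 1 ->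
  sg d * x 0 0 = u0 + 11 / 30 * t -> sg e * x 0 1 = u1 + 11 / 30 * t ->
  sg f * x 0 2 = u2 + 11 / 30 * t ->
  ~ octa8_solid (face_reflection a b c x).
Proof.
move=> G1 G2 u0_ge0 u1_ge0 u2_ge0 sum t01 x0 x1 x2 inU.
have neq : ~~ ((a (+) d == b (+) e) && (b (+) e == c (+) f)).
  by move: G1 G2; clear; case: a; case: b; case: c; case: d; case: e; case: f.
have sgM g h (z : R) : sg g * z = sg (g (+) h) * (sg h * z).
  by rewrite signr_addb -mulrA signrMK.
have sg2 g : sg g * sg g = 1 by rewrite -expr2 sqrr_sign.
have xO : solid_octahedron (face_reflection a b c (face_reflection a b c x)).
  have [E0 E1 E2] := reflectionE a b c x; rewrite dot_sign in E0 E1 E2.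
  pose r := sg (a (+) d) * (sg d * x 0 0) + sg (b (+) e) * (sg e * x 0 1) +
            sg (c (+) f) * (sg f * x 0 2).
  have rE : x 0 0 * sg a + x 0 1 * sg b + x 0 2 * sg c = r.
    by rewrite /r -!sgM; ring.
  rewrite rE in E0 E1 E2.
  have F g h (z : R) : sg g * (z - 2 * (r - 1) / 3 * sg g) =
      sg (g (+) h) * (sg h * z) - 2 * (r - 1) / 3.
    by rewrite -sgM mulrBr mulrCA sg2 mulr1.
  have [y0 /andP[rlo rhi]] := reflected_bump neq u0_ge0 u1_ge0 u2_ge0 sum t01 x0 x1 x2.
  have neq1 : ~~ ((b (+) e == c (+) f) && (c (+) f == a (+) d)).
    by move: neq; clear; case: (a (+) d); case: (b (+) e); case: (c (+) f).
  have neq2 : ~~ ((c (+) f == a (+) d) && (a (+) d == b (+) e)).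
    by move: neq; clear; case: (a (+) d); case: (b (+) e); case: (c (+) f).
  have sum1 : u1 + u2 + u0 = 1 - t by rewrite -sum; ring.
  have sum2 : u2 + u0 + u1 = 1 - t by rewrite -sum; ring.
  have [y1 _] := reflected_bump neq1 u1_ge0 u2_ge0 u0_ge0 sum1 t01 x1 x2 x0.
  have [y2 _] := reflected_bump neq2 u2_ge0 u0_ge0 u1_ge0 sum2 t01 x2 x0 x1.
  have r1 : sg (b (+) e) * (sg e * x 0 1) + sg (c (+) f) * (sg f * x 0 2) +
            sg (a (+) d) * (sg d * x 0 0) = r by rewrite /r; ring.
  have r2 : sg (c (+) f) * (sg f * x 0 2) + sg (a (+) d) * (sg d * x 0 0) +
            sg (b (+) e) * (sg e * x 0 1) = r by rewrite /r; ring.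
  rewrite r1 in y1; rewrite r2 in y2; rewrite -/r in y0 rlo rhi.
  apply: octa8_inside inU.
  - by rewrite E0 (F a d).
  - by rewrite E1 (F b e).
  - by rewrite E2 (F c f).
  rewrite E0 E1 E2 (F a d) (F b e) (F c f).
  have -> : sg (a (+) d) * (sg d * x 0 0) - 2 * (r - 1) / 3 +
     (sg (b (+) e) * (sg e * x 0 1) - 2 * (r - 1) / 3) +
     (sg (c (+) f) * (sg f * x 0 2) - 2 * (r - 1) / 3) = 2 - r.
    by rewrite /r; field.
  by apply/andP; split; lra.
move: xO; rewrite reflectionK => /solid_octahedronP /(_ d e f).
by move: x0 x1 x2 sum t01; lra.
Qed.

Lemma interior_shift (L cell : set V) v p (e : R) : L v -> 0 < e ->
  (forall y, (forall i, `|y 0 i - p 0 i| < e) -> cell y) ->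
  interior (translates L cell) (p + v).
Proof.
move=> Lv e0 near_p; apply: (interior_box e0) => x xp; exists v => //.
by apply: near_p => i; have := xp i; rewrite !mxE opprD addrA addrAC.
Qed.

(** Near the centre of a face the octahedron and its reflection fill both
    sides. *)
Lemma octa8_near_face a b c y :
  (forall i, `|y 0 i - (3^-1 *: sign_vector R a b c) 0 i| < 1 / 9) -> octa8_cell y.
Proof.
have [E0 E1 E2] := sign_vectorE R a b c.
have scaleE (k : R) (n : V) i : (k *: n) 0 i = k * n 0 i by rewrite mxE.
move=> near_c; have := near_c 0; have := near_c 1; have := near_c 2.
rewrite !scaleE E0 E1 E2 => near2 near1 near0.
have zE (g : bool) (u : R) : `|u - 3^-1 * sg g| < 1 / 9 -> 2 / 9 < sg g * u < 4 / 9.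
  rewrite ltr_norml => /andP[]; case: g; rewrite /= ?expr0 ?expr1 => ? ?;
    apply/andP; split; lra.
have /andP[x0 x0'] := zE _ _ near0; have /andP[x1 x1'] := zE _ _ near1.
have /andP[x2 x2'] := zE _ _ near2.
apply/octa8_cellE.
have [sum1|sum1] := lerP (sg a * y 0 0 + sg b * y 0 1 + sg c * y 0 2) 1.
  by left; apply: (@solid_octant _ y a b c) => //; lra.
right; exists a, b, c.
have [F0 F1 F2] := reflectionE a b c y; rewrite dot_sign in F0 F1 F2.
have sg2 g : sg g * sg g = 1 by rewrite -expr2 sqrr_sign.
pose r := sg a * y 0 0 + sg b * y 0 1 + sg c * y 0 2.
have rE : y 0 0 * sg a + y 0 1 * sg b + y 0 2 * sg c = r by rewrite /r; ring.
rewrite -/r in sum1; rewrite rE in F0 F1 F2.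
have F g (z : R) : sg g * (z - 2 * (r - 1) / 3 * sg g) = sg g * z - 2 * (r - 1) / 3.
  by rewrite mulrBr mulrCA sg2 mulr1.
apply: (@solid_octant _ _ a b c); rewrite ?F0 ?F1 ?F2 ?F;
  by move: sum1; rewrite /r; lra.
Qed.

Lemma octahedron_face_centroid a b c :
  hull (octahedron_face R a b c) (3^-1 *: sign_vector R a b c).
Proof.
have -> : 3^-1 *: sign_vector R a b c =
    (size (octahedron_face R a b c))%:R^-1 *: \sum_(v <- octahedron_face R a b c) v.
  have rev3 (u v w : V) : u + v + w = w + (v + (u + 0)).
    by rewrite addr0 [LHS]addrC [u + v]addrC.
  rewrite /octahedron_face /sign_vector; case: ifP => _; rewrite unlock /=.
    by rewrite rev3.
  by rewrite addr0 addrA.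
apply: centroid_hull; rewrite /octahedron_face; case: ifP => _ //.
Qed.

Lemma reflected_face_centroid a b c d e f :
  hull (rev (map (@face_reflection R a b c) (octahedron_face R d e f)))
    (face_reflection a b c (3^-1 *: sign_vector R d e f)).
Proof.
have := hull_affine (@reflection_affine R a b c) (octahedron_face_centroid d e f).
by apply: hull_sub => v; rewrite mem_rev.
Qed.

(** The reflection carries segments to segments, so the outside witness is the
    reflection of 11/30 of the normal vector of G. *)
Lemma octa8_face_boundary a b c d e f :
  (d, e, f) != (a, b, c) -> (d, e, f) != (~~ a, ~~ b, ~~ c) ->
  hull (rev (map (@face_reflection R a b c) (octahedron_face R d e f))) `<=`
    boundary octa8_solid.
Proof.
move=> G1 G2; set s := rev _.
have pull p : hull s p -> exists2 x, hull (octahedron_face R d e f) x &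
    p = face_reflection a b c x.
  move=> /(hull_affine (@reflection_affine R a b c)).
  rewrite /s map_rev -map_comp => hp; exists (face_reflection a b c p).
    apply: hull_sub hp => v; rewrite mem_rev => /mapP[w wF ->] /=.
    by rewrite reflectionK.
  by rewrite reflectionK.
apply: (face_boundary (m := face_reflection a b c ((11 / 30) *: sign_vector R d e f))).
  move=> p /pull[x /hull_octahedron_face[x0 x1 x2 sum] ->].
  exists 0; first exact: lattice0.
  rewrite subr0; apply/octa8_cellE; right; exists a, b, c; rewrite reflectionK.
  by apply: solid_octant x0 x1 x2 _; rewrite sum.
move=> p t /pull[x /hull_octahedron_face[x0 x1 x2 sum] ->] t01.
rewrite -(affine_segment _ _ _ (@reflection_affine R a b c)).
have t1 : 0 <= 1 - t by move: t01 => /andP[_]; lra.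
have [E0 E1 E2] := sign_vectorE R d e f.
have lin (k : R) (u v : V) i :
    (u + t *: (k *: v - u)) 0 i = u 0 i + t * (k * v 0 i - u 0 i).
  by rewrite !mxE.
have sg2 g : sg g * sg g = 1 by rewrite -expr2 sqrr_sign.
have coord g (z : R) : sg g * (z + t * (11 / 30 * sg g - z)) =
    (1 - t) * (sg g * z) + 11 / 30 * t.
  have := sg2 g; move: (sg g) => S SS.
  transitivity ((1 - t) * (S * z) + 11 / 30 * t * (S * S)); last by rewrite SS mulr1.
  by field.
apply: (octa8_out G1 G2 (mulr_ge0 t1 x0) (mulr_ge0 t1 x1) (mulr_ge0 t1 x2) _ t01).
- by rewrite -!mulrDr sum mulr1.
- by rewrite lin E0 coord.
- by rewrite lin E1 coord.
- by rewrite lin E2 coord.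
Qed.

Lemma octants_all F : F \in octants.
Proof. by case: F => [[[] []] []]. Qed.

Lemma octa8_face_in a b c d e f :
  (d, e, f) != (a, b, c) -> (d, e, f) != (~~ a, ~~ b, ~~ c) ->
  rev (map (reflect3 (a, b, c)) (octa_face3 (d, e, f))) \in octa8_faces3.
Proof.
move=> G1 G2; apply/flatten_mapP; exists (a, b, c); first exact: octants_all.
by apply/mapP; exists (d, e, f); rewrite // mem_filter octants_all andbT G1.
Qed.

(** The faces of O, and the reflections in F of F and of its opposite, are
    shared by two octahedra of the periodic solid: their centres are interior
    points. For the opposite of F the second octahedron is the translate of O
    by 4/3 of the normal vector of F. *)
Lemma octa8_modelled : modelled 3 3 octa8_test octa8_faces3
  (@octa8_lattice R) (@octa8_cell R) (@octa8_faces R).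
Proof.
split.
- exact: octa8_latticeE.
- have sizes : all (fun t => size t == 3) octa8_faces3 by vm_compute.
  by move=> s /(allP sizes)/eqP.
have inner a b c v : octa8_lattice v ->
    ~ boundary octa8_solid (3^-1 *: sign_vector R a b c + v).
  move=> Lv [_]; apply; apply: (interior_shift (e := 1 / 9)) Lv _ _; first by lra.
  exact: octa8_near_face.
have L0 : octa8_lattice (0 : V) by exact: lattice0.
move=> s; split=> [[]|[s' + ->]].
  case=> [[a [b [c ->]]] hs|[a [b [c [s' [d [e [f ->]]] ->]]]] hs].
    have := inner a b c 0 L0; rewrite addr0 => /(_ (hs _ _)) [].
    exact: octahedron_face_centroid.
  have := hs _ (reflected_face_centroid a b c d e f).
  have scaleE (k : R) (n : V) i : (k *: n) 0 i = k * n 0 i by rewrite mxE.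
  have addE (u w : V) l : (u + w) 0 l = u 0 l + w 0 l by rewrite mxE.
  have [/eqP[-> -> ->]|G1] := boolP ((d, e, f) == (a, b, c)).
    have -> : face_reflection a b c (3^-1 *: sign_vector R a b c) =
        3^-1 *: sign_vector R a b c + 0.
      have [E0 E1 E2] := sign_vectorE R a b c.
      have [F0 F1 F2] := reflectionE a b c (3^-1 *: sign_vector R a b c).
      by apply: row3P; rewrite addr0 ?F0 ?F1 ?F2 dot_sign !scaleE E0 E1 E2;
        case: (a); case: (b); case: (c); rewrite /= ?expr0 ?expr1; field.
    by move=> /(inner _ _ _ _ L0).
  have [/eqP[-> -> ->]|G2] := boolP ((d, e, f) == (~~ a, ~~ b, ~~ c)).
    have -> : face_reflection a b c (3^-1 *: sign_vector R (~~ a) (~~ b) (~~ c)) =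
        3^-1 *: sign_vector R (~~ a) (~~ b) (~~ c) + (4 / 3) *: sign_vector R a b c.
      have [E0 E1 E2] := sign_vectorE R a b c.
      have [G0 G1' G2] := sign_vectorE R (~~ a) (~~ b) (~~ c).
      have [F0 F1 F2] := reflectionE a b c (3^-1 *: sign_vector R (~~ a) (~~ b) (~~ c)).
      by apply: row3P; rewrite ?F0 ?F1 ?F2 dot_sign addE !scaleE ?E0 ?E1 ?E2 G0 G1' G2;
        case: (a); case: (b); case: (c); rewrite /= ?expr0 ?expr1; field.
    by move=> /inner []; apply: lattice_gen; exists a, b, c.
  move=> _; exists (rev (map (reflect3 (a, b, c)) (octa_face3 (d, e, f)))).
    exact: octa8_face_in.
  by rewrite map_rev -reflection_vec.
move=> /flatten_mapP[[[a b] c] _ /mapP[[[d e] f]]].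
rewrite mem_filter => /andP[/andP[G1 G2] _] ->.
rewrite map_rev -reflection_vec; split; last exact: octa8_face_boundary.
right; exists a, b, c, (octahedron_face R d e f) => //.
by exists d, e, f.
Qed.

End Octa8.

(** * The cube *)

Section Cube.
Variable R : realType.
Local Notation V := 'rV[R]_3.
Local Notation vec := (vec R 1).
Implicit Types (x y p m : V) (U : set V) (i j l : 'I_3) (b : bool).

Lemma vec1E (w : int3) l : vec w 0 l = (coord3 w l)%:~R.
Proof. by rewrite vecE divr1. Qed.

Lemma coord3_unit (k l : nat) : (l < 3)%N -> coord3 (unit3 k) l = (l == k)%N.
Proof. by case: l => [|[|[|]]] // _; rewrite /coord3 /= eq_sym. Qed.

Lemma basis_vec i : basis R i = vec (unit3 i).
Proof. by apply/rowP => l; rewrite vec1E basisE coord3_unit. Qed.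

Lemma shift_vec (d : int3) (s : seq int3) :
  shift (vec d) (map vec s) = map vec [seq w + d | w <- s].
Proof. by rewrite /shift -!map_comp; apply: eq_map => w /=; rewrite vecD. Qed.

Lemma cube_faceE i b : cube_face R i b = map vec (square3 (i : nat, b)).
Proof.
have E1 : basis R (i + 1) = vec (unit3 (i.+1 %% 3)).
  by rewrite basis_vec; case: (i) => [[|[|[|//]]] i3].
have E2 : basis R (i + 2) = vec (unit3 (i.+2 %% 3)).
  by rewrite basis_vec; case: (i) => [[|[|[|//]]] i3].
have v0 : vec 0 = 0 by have := vecB R 1 0 0; rewrite !subrr.
rewrite /cube_face /square3 E1 E2; case: b.
  by rewrite scale1r basis_vec /= !vecD.
by rewrite scale0r -v0 -!vecD map_rev.
Qed.

(** Bounds on the coordinates of a face reduce to an inspection of its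
    vertices. *)
Lemma hull_vec_coord (s : seq int3) (l : 'I_3) (lo hi : int) x :
  all (fun w => lo <= coord3 w l <= hi) s -> hull (map vec s) x ->
  lo%:~R <= x 0 l <= hi%:~R.
Proof.
move=> /allP bounds hx.
have up (k : R) : scalar (fun y : V => k * y 0 l).
  by move=> c y z; rewrite !mxE; ring.
apply/andP; split.
  rewrite -lerN2 -[X in X <= _]mulN1r; apply: (hull_le (up (-1)) hx).
  move=> _ /mapP[w /bounds /andP[w0 _] ->]; rewrite vec1E mulN1r lerN2.
  by rewrite ler_int.
rewrite -[leLHS]mul1r; apply: (hull_le (up 1) hx).
by move=> _ /mapP[w /bounds /andP[_ w1] ->]; rewrite vec1E mul1r ler_int.
Qed.

Lemma square3_bounds i b l :
  all (fun w => (if l == i then b%:Z else 0) <= coord3 w l <=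
                (if l == i then b%:Z else 1))
    (square3 (i : nat, b)).
Proof. by case: i => [[|[|[|//]]] i3]; case: l => [[|[|[|//]]] l3]; case: b. Qed.

Lemma hull_cube_face i b x : hull (cube_face R i b) x ->
  forall l, if l == i then x 0 l = b%:R else 0 <= x 0 l <= 1.
Proof.
rewrite cube_faceE => hx l; have := hull_vec_coord (square3_bounds i b l) hx.
case: eqP => // _ /andP[lo hi]; apply/eqP; rewrite eq_le.
by case: b {hx} lo hi => /= lo hi; apply/andP; split.
Qed.

Lemma cube_boundary i b :
  hull (cube_face R i b) `<=` boundary (translates [set 0] (@solid_cube R)).
Proof.
rewrite translates0; apply: (face_boundary (m := (3 * b%:R - 1) *: basis R i)).
  move=> x hx l; have := hull_cube_face hx l; case: eqP => // _ ->.
  by case: (b); rewrite /= ?ler01 lexx.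
move=> p t hp /andP[t0 t1] /(_ i); have := hull_cube_face hp i; rewrite eqxx => pE.
have -> : (p + t *: ((3 * b%:R - 1) *: basis R i - p)) 0 i =
    p 0 i + t * ((3 * b%:R - 1) - p 0 i).
  by rewrite !mxE !eqxx mulr1.
by rewrite pE => /andP[]; case: (b) => /=; lra.
Qed.

Lemma cube_sides_mem i b : (i : nat, b) \in cube_sides.
Proof. by apply/allpairsP; exists (i : nat, b); rewrite mem_iota ltn_ord; case: b. Qed.

Lemma cube_sidesP ib : ib \in cube_sides -> exists i b, ib = (i : nat, b).
Proof.
move=> /allpairsP[[k b] [+ _ ->]]; rewrite mem_iota => /andP[_ k3].
by exists (Ordinal k3), b.
Qed.

Lemma cube_modelled : modelled 1 4 (pred1 0) cube_faces3 [set 0]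
  (@solid_cube R) (@cube_faces R).
Proof.
split.
- move=> v; have v0 : vec 0 = 0 by have := vecB R 1 0 0; rewrite !subrr.
  by split=> [->|[d /eqP-> ->]]; [exists 0; rewrite //= eqxx|rewrite v0].
- have sizes : all (fun t => size t == 4) cube_faces3 by vm_compute.
  by move=> s /(allP sizes)/eqP.
- move=> s; split=> [[[i [b ->]] _]|[_ /mapP[ib /cube_sidesP[i [b ->]] ->] ->]].
    exists (square3 (i : nat, b)); last exact: cube_faceE.
    by apply: map_f; exact: cube_sides_mem.
  rewrite -cube_faceE; split; first by exists i, b.
  exact: cube_boundary.
Qed.

End Cube.

(** * Mucube *)

Section Mucube.
Variable R : realType.
Local Notation V := 'rV[R]_3.
Local Notation vec := (vec R 1).
Implicit Types (x y p m : V) (U : set V) (i j l : 'I_3) (b : bool).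

Lemma mucube_testP (w : int3) : mucube_test w <-> exists k0 k1 k2 : int,
  w = int3_of (k0 * 2) (k1 * 2) (k2 * 2).
Proof.
case: w => [[w0 w1] w2]; rewrite /mucube_test /=; split.
  by move=> /and3P[/dvdzP[k0 ->] /dvdzP[k1 ->] /dvdzP[k2 ->]]; exists k0, k1, k2.
by case=> k0 [k1 [k2 [-> -> ->]]]; rewrite !dvdz_mull.
Qed.

Lemma mucube_test_lattice : lattice_test mucube_test.
Proof.
split=> // x y /mucube_testP[k0 [k1 [k2 ->]]] /mucube_testP[j0 [j1 [j2 ->]]].
apply/mucube_testP; exists (k0 - j0), (k1 - j1), (k2 - j2).
by congr (_, _, _) => /=; lia.
Qed.

Lemma mucube_generator i : 2 *: basis R i = vec (unit3 i *+ 2).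
Proof. by rewrite basis_vec -[unit3 i *+ 2]/(unit3 i + unit3 i) vecD scaler_nat. Qed.

Lemma mucube_latticeE v : @mucube_lattice R v <-> exists2 d, mucube_test d & v = vec d.
Proof.
have gen i : mucube_test (unit3 i *+ 2).
  by case: i => [[|[|[|//]]] i3].
split.
  have [_ testB] := mucube_test_lattice.
  elim=> {v} [|v g _ [d Dd ->] [i ->]|v g _ [d Dd ->] [i ->]].
  - by exists 0 => //; have := vecB R 1 0 0; rewrite !subrr.
  - exists (d + unit3 i *+ 2); first exact: (lattice_testD mucube_test_lattice).
    by rewrite vecD mucube_generator.
  - exists (d - unit3 i *+ 2); first exact: testB.
    by rewrite vecB mucube_generator.
case=> d /mucube_testP[k0 [k1 [k2 ->]]] ->.
have Lg i : mucube_lattice (2 *: basis R i) by apply: lattice_gen; exists i.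
have -> : vec (int3_of (k0 * 2) (k1 * 2) (k2 * 2)) =
    (2 *: basis R 0) *~ k0 + (2 *: basis R 1) *~ k1 + (2 *: basis R 2) *~ k2.
  have mulE (u : V) (n : int) l : (u *~ n) 0 l = u 0 l * n%:~R.
    by rewrite -scaler_int mxE mulrC.
  have addE (u w : V) l : (u + w) 0 l = u 0 l + w 0 l by rewrite mxE.
  have gE i l : (2 *: basis R i) 0 l = 2 * (l == i)%:R by rewrite mxE basisE.
  by apply: row3P; rewrite vec1E !addE !mulE !gE /coord3 /= intrM; ring.
exact: lattice_add (lattice_add (lattice_mulz _ (Lg _)) (lattice_mulz _ (Lg _)))
  (lattice_mulz _ (Lg _)).
Qed.

Lemma mucube_lattice_coord v : @mucube_lattice R v ->
  exists k : 'I_3 -> int, forall l, v 0 l = (2 * k l)%:~R.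
Proof.
move=> /mucube_latticeE[d /mucube_testP[k0 [k1 [k2 ->]]] ->].
exists (fun l => nth 0 [:: k0; k1; k2] l) => l; rewrite vec1E; congr (_%:~R).
by case: l => [[|[|[|//]]] l3]; rewrite /coord3 /= mulrC.
Qed.

Definition mucube_solid : set V := translates (@mucube_lattice R) (@mucube_cell R).

(** The unit cubes of the solid have corners with at most one odd coordinate. *)
Lemma mucube_inside x (n : 'I_3 -> int) i j : i != j ->
  (forall l, (n l)%:~R < x 0 l < (n l)%:~R + 1) -> mucube_solid x ->
  ~~ (odd `|n i|%N && odd `|n j|%N).
Proof.
move=> ij xn [v /mucube_lattice_coord[k vk] cell_xv].
have [e [ev ec]] : exists e : 'I_3 -> bool, ~~ (e i && e j) /\
    forall l, (e l)%:R <= (x - v) 0 l <= (e l)%:R + 1.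
  case: cell_xv => [inC|[h inC]].
    by exists (fun=> false); split=> // l; have := inC l; rewrite add0r.
  exists (fun l => l == h); split.
    by apply/negP => /andP[/eqP ih /eqP jh]; rewrite ih jh eqxx in ij.
  move=> l; have := inC l; rewrite [(_ - basis R h) 0 l]mxE [(- basis R h) 0 l]mxE.
  by rewrite basisE; lra.
have nE l : n l = 2 * k l + (e l : nat)%:Z.
  have := ec l; have := xn l; rewrite !mxE vk => /andP[x0 x1] /andP[y0 y1].
  have lo : (n l)%:~R < (2 * k l + (e l : nat)%:Z + 1)%:~R :> R.
    by rewrite !intrD -pmulrn; lra.
  have hi : (2 * k l + (e l : nat)%:Z)%:~R < (n l + 1)%:~R :> R.
    by rewrite !intrD -pmulrn; lra.
  by move: lo hi; rewrite !ltr_int; lia.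
have oddE l : odd `|n l|%N = e l.
  by rewrite nE; case: (e l) => /=; lia.
by rewrite !oddE.
Qed.

(** The cubes of the solid fill a tube of unit square section along each axis.
    *)
Lemma mucube_tube i y : (forall l, l != i -> 0 <= y 0 l <= 1) ->
  -1 <= y 0 i <= 3 -> mucube_solid y.
Proof.
move=> yl /andP[y0 y3].
have coordE (u w : V) l : (u - w) 0 l = u 0 l - w 0 l by rewrite !mxE.
have L0 : mucube_lattice (0 : V) by exact: lattice0.
have Lp : mucube_lattice (2 *: basis R i) by apply: lattice_gen; exists i.
have Lm : mucube_lattice (- (2 *: basis R i)) by exact: lattice_opp.
have gE l : (2 *: basis R i) 0 l = 2 * (l == i)%:R by rewrite mxE basisE.
have gN l : (- (2 *: basis R i)) 0 l = - (2 * (l == i)%:R) by rewrite mxE gE.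
have [yn|yn] := lerP (y 0 i) 0.
  exists (- (2 *: basis R i)) => //; right; exists i => l.
  rewrite !coordE gN basisE; case: (eqVneq l i) => [->|/yl /andP[? ?]] /=;
    by apply/andP; split; lra.
have [y1|y1] := lerP (y 0 i) 1.
  exists 0 => //; left => l; rewrite subr0.
  by case: (eqVneq l i) => [->|/yl //]; apply/andP; split; lra.
have [y2|y2] := lerP (y 0 i) 2.
  exists 0 => //; right; exists i => l; rewrite subr0 coordE basisE.
  by case: (eqVneq l i) => [->|/yl /andP[? ?]] /=; apply/andP; split; lra.
exists (2 *: basis R i) => //; left => l; rewrite coordE gE.
by case: (eqVneq l i) => [->|/yl /andP[? ?]] /=; apply/andP; split; lra.
Qed.

Lemma hull_shift (s : seq V) v x : hull (shift v s) x <-> hull s (x - v).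
Proof.
have shift_affine w : linear (fun y : V => (y + w) - (0 + w)).
  by move=> k y z; rewrite add0r !addrK.
split=> [/(hull_affine (shift_affine (- v)))|/(hull_affine (shift_affine v))].
  by rewrite -map_comp; apply: hull_sub => w /mapP[u us ->] /=; rewrite addrK.
by rewrite subrK.
Qed.

Lemma cube_face_centroid i b :
  hull (cube_face R i b) (\row_l (if l == i then b%:R else 2^-1)).
Proof.
rewrite cube_faceE; set s := square3 _.
have sumE l : \sum_(w <- s) coord3 w l = if l == i then 4 * (b : nat)%:Z else 2.
  rewrite unlock /s.
  by case: (i) => [[|[|[|//]]] i3]; case: l => [[|[|[|//]]] l3]; case: (b).
have szE : size (map vec s) = 4%N by rewrite size_map /s; case: (b).
have -> : \row_l (if l == i then b%:R else 2^-1) =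
    (size (map vec s))%:R^-1 *: \sum_(v <- map vec s) v.
  apply/rowP => l; rewrite szE !mxE summxE big_map.
  under eq_bigr do rewrite vec1E.
  by rewrite -rmorph_sum sumE; case: eqP => _; rewrite ?intrM -?pmulrn; field.
by apply: centroid_hull; rewrite -size_eq0 szE.
Qed.

Lemma mucube_inner i (c : V) : (forall l, l != i -> c 0 l = 2^-1) ->
  0 <= c 0 i <= 2 -> ~ boundary mucube_solid c.
Proof.
move=> cl /andP[c0 c2] [_]; apply.
apply: (@interior_box _ _ _ 2^-1) => [|x xc]; first by lra.
apply: (@mucube_tube i) => [l li|].
  by have := xc l; rewrite cl // ltr_norml => /andP[? ?]; apply/andP; split; lra.
by have := xc i; rewrite ltr_norml => /andP[? ?]; apply/andP; split; lra.
Qed.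

(** The face i of the cube shifted along j is a face of the unit cube with
    corner n, which has two odd coordinates, i and j. The centre of this cube
    is the outside witness. *)
Lemma mucube_face_boundary i j b : j != i ->
  hull (shift (basis R j) (cube_face R i b)) `<=` boundary mucube_solid.
Proof.
move=> ji.
(* The corner of the adjacent unit cube outside the solid. *)
pose n l : int := if l == i then (if b then 1 else -1) else Posz (l == j).
have bounds p : hull (shift (basis R j) (cube_face R i b)) p ->
    forall l, (n l)%:~R <= p 0 l <= (n l)%:~R + 1.
  move=> /hull_shift hp l; have := hull_cube_face hp l.
  have -> : (p - basis R j) 0 l = p 0 l - (l == j)%:R.
    by rewrite [LHS]mxE [(- basis R j) 0 l]mxE basisE.
  rewrite /n; case: eqP => [->|_].
    rewrite eq_sym (negPf ji) subr0 => ->.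
    by case: (b) => /=; apply/andP; split; lra.
  by move=> /andP[? ?]; rewrite -pmulrn; apply/andP; split; lra.
apply: (face_boundary (m := \row_l ((n l)%:~R + 2^-1))).
  move=> p /hull_shift hp; exists 0; first exact: lattice0.
  rewrite subr0; right; exists j => l; have := hull_cube_face hp l.
  by case: eqP => // _ ->; case: (b); rewrite /= ?ler01 lexx.
move=> p t hp /andP[t0 t1] inU.
have box l : (n l)%:~R < (p + t *: (\row_l ((n l)%:~R + 2^-1) - p)) 0 l <
    (n l)%:~R + 1.
  rewrite !mxE; have /andP[] := bounds p hp l.
  move: (p 0 l) ((n l)%:~R : R) => u v u0 u1.
  have A : 0 <= (1 - t) * (u - v) by apply: mulr_ge0; lra.
  have B : 0 <= (1 - t) * (v + 1 - u) by apply: mulr_ge0; lra.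
  by apply/andP; split; move: A B; lra.
have ij : i != j by rewrite eq_sym.
have := mucube_inside ij box inU; rewrite /n !eqxx (negPf ji).
by case: (b).
Qed.

(** A face orthogonal to e_i, of the unit cube or of its shift along e_i,
    separates two consecutive cubes of a tube and is not on the boundary. *)
Lemma mucube_modelled : modelled 1 4 mucube_test mucube_faces3
  (@mucube_lattice R) (@mucube_cell R) (@mucube_faces R).
Proof.
have faceE i j b : shift (basis R j) (cube_face R i b) =
    map vec [seq w + unit3 j | w <- square3 (i : nat, b)].
  by rewrite cube_faceE basis_vec shift_vec.
have iotaP (k : nat) : k \in iota 0 3 -> exists j, k = j.
  by rewrite mem_iota => /andP[_ k3]; exists (Ordinal k3).
split.
- exact: mucube_latticeE.
- have sizes : all (fun t => size t == 4) mucube_faces3 by vm_compute.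
  by move=> s /(allP sizes)/eqP.
move=> s; split=> [[]|[_ /mapP[[k ib] + ->] ->]].
  case=> [[i [b ->]] hs|[j [_ [i [b ->]] ->]] hs].
    have /hs := cube_face_centroid i b; case/(mucube_inner (i := i)) => //.
      by move=> l /negPf li; rewrite mxE li.
    by rewrite mxE eqxx; case: (b); rewrite /= ?ler01 ?lexx ?ler0n //= ler_nat.
  have [ji|ji] := eqVneq j i.
    have /hs : hull (shift (basis R j) (cube_face R i b))
        (\row_l (if l == i then b%:R else 2^-1) + basis R j).
      by apply/hull_shift; rewrite addrK; exact: cube_face_centroid.
    have cE l : (\row_l (if l == i then b%:R else 2^-1) + basis R j) 0 l =
        (if l == i then b%:R else 2^-1) + (l == i)%:R.
      by rewrite [LHS]mxE [(\row__ _) 0 l]mxE basisE ji.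
    case/(mucube_inner (i := i)) => //.
      by move=> l /negPf li; rewrite cE li addr0.
    by rewrite cE eqxx; case: (b) => /=; apply/andP; split; lra.
  exists [seq w + unit3 j | w <- square3 (i : nat, b)]; last exact: faceE.
  apply/mapP; exists (j : nat, (i : nat, b)) => //.
  rewrite mem_filter; apply/andP; split; first exact: ji.
  apply/allpairsP; exists (j : nat, (i : nat, b)).
  by rewrite mem_iota ltn_ord cube_sides_mem.
rewrite mem_filter => /andP[ki /allpairsP[[k' ib']]].
case=> /iotaP[j jE] /cube_sidesP[i [b ibE]] [kE ibE'].
have {}kE : k = j by rewrite kE; exact: jE.
have {}ibE : ib = (i : nat, b) by rewrite ibE'; exact: ibE.
rewrite kE ibE in ki *.
rewrite -faceE; split; last exact: mucube_face_boundary.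
by right; exists j, (cube_face R i b) => //; exists i, b.
Qed.

End Mucube.

(** * Comparison of the translation covers *)

Theorem theorem1p1 (R : realType) :
  (forall (f : tile (octahedron R)) (g : tile (octa8_quotient R)),
     isometric (translation_cover f) (translation_cover g)) /\
  (forall (f : tile (cube R)) (g : tile (mucube_quotient R)),
     isometric (translation_cover f) (translation_cover g)).
Proof.
split=> f g.
(* In the coordinates scaled by 3 the squared length of an edge is 18. *)
- by apply: (@isometric_models 3 _ _ _ _ 0 _ R 3 18 _ _ _ _ _ _ _ _
    octa8_test_lattice (octahedron_modelled R) (octa8_modelled R) _
    octa8_covering_test).
- by apply: (@isometric_models 4 _ _ _ _ (int3_of 1 1 1) _ R 1 1 _ _ _ _ _ _ _ _
    mucube_test_lattice (cube_modelled R) (mucube_modelled R) _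
    mucube_covering_test).
Qed.
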